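(* Let $\mathscr{H}$ be a Hilbert $C^*$-module. For every idempotent $Q\in\mathcal{L}(\mathscr{H})$, its matched pair $(m(Q),Q)$ is semi-harmonious if and only if $P_{\mathcal{R}(Q)}-Q$ has the polar decomposition.
   Context: $\mathfrak{A}$ is a $C^*$-algebra and $\mathscr{H}$ is a (right) Hilbert $\mathfrak{A}$-module; $\mathcal{L}(\mathscr{H})$ is the $C^*$-algebra of adjointable operators on $\mathscr{H}$, and $I$ is the identity operator on $\mathscr{H}$. For $T\in\mathcal{L}(\mathscr{H})$, $\mathcal{R}(T)$ and $T^*$ denote its range and adjoint, $|T|=(T^*T)^{1/2}$ and $|T^*|=(TT^* )^{1/2}$; the bar denotes norm closure. An idempotent is $Q\in\mathcal{L}(\mathscr{H})$ with $Q^2=Q$; a projection is a self-adjoint idempotent. A closed submodule $\mathscr{M}$ of $\mathscr{H}$ is orthogonally complemented in $\mathscr{H}$ if $\mathscr{H}=\mathscr{M}+\mathscr{M}^\perp$; then $P_{\mathscr{M}}$ denotes the projection from $\mathscr{H}$ onto $\mathscr{M}$. (The range of an adjointable idempotent is always orthogonally complemented.) $T\in\mathcal{L}(\mathscr{H})$ has the polar decomposition if there is a partial isometry $U\in\mathcal{L}(\mathscr{H})$ with $T=U|T|$ and $U^*U=P_{\overline{\mathcal{R}(T^* )}}$ (in particular $\overline{\mathcal{R}(T^* )}$ is orthogonally complemented). A quasi-projection pair $(P,Q)$ on $\mathscr{H}$ consists of a projection $P\in\mathcal{L}(\mathscr{H})$ and an idempotent $Q\in\mathcal{L}(\mathscr{H})$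 such that $PQ^*P=PQP$, $PQ^*(I-P)=-PQ(I-P)$ and $(I-P)Q^*(I-P)=(I-P)Q(I-P)$; equivalently, $Q^*=(2P-I)Q(2P-I)$. A quasi-projection pair $(P,Q)$ is semi-harmonious if both $P(I-Q)$ and $(I-P)Q$ have the polar decomposition. For an idempotent $Q\in\mathcal{L}(\mathscr{H})$, its matched projection is $$m(Q)=\tfrac12\big(|Q^*|+Q^*\big)|Q^*|^\dagger\big(|Q^*|+I\big)^{-1}\big(|Q^*|+Q\big),$$ where $|Q^*|^\dagger$ is the Moore–Penrose inverse of $|Q^*|$, which exists and equals $\big(P_{\mathcal{R}(Q)}P_{\mathcal{R}(Q^* )}P_{\mathcal{R}(Q)}\big)^{1/2}$. It is known that $m(Q)$ is a projection and $(m(Q),Q)$ is a quasi-projection pair, called the matched pair of $Q$. *)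

(* Defs.v *)
From HB Require Import structures.
From mathcomp Require Import all_boot all_order all_algebra complex.
From mathcomp Require Import all_classical all_reals all_analysis.

Set Implicit Arguments.
Unset Strict Implicit.
Unset Printing Implicit Defensive.

Import GRing.Theory Num.Theory.
Import numFieldNormedType.Exports.

Local Open Scope classical_set_scope.
Local Open Scope ring_scope.
Local Open Scope complex_scope.

(* A C*-algebra is not assumed unital, so its product is an operation [amul]
   and not that of a MathComp ring; it may also be the zero algebra. *)
HB.mixin Record isCStarAlgebra (R : realType) A
    of CompleteNormedModule R[i] A := {
  amul : A -> A -> A;
  astar : A -> A;
  amulA : associative amul;
  amulDl : left_distributive amul +%R;
  amulDr : right_distributive amul +%R;
  amulZl : forall (k : R[i]) a b, amul (k *: a) b = k *: amul a b;
  amulZr : forall (k : R[i]) a b, amul a (k *: b) = k *: amul a b;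
  astarK : involutive astar;
  astarD : {morph astar : a b / a + b};
  astarZ : forall (k : R[i]) a, astar (k *: a) = Num.conj k *: astar a;
  astarM : forall a b, astar (amul a b) = amul (astar b) (astar a);
  anormM : forall a b, `|amul a b| <= `|a| * `|b|;
  anorm_star : forall a, `|amul (astar a) a| = `|a| ^+ 2
}.

#[short(type="cstarAlgType")]
HB.structure Definition CStarAlgebra (R : realType) :=
  {A of CompleteNormedModule R[i] A & isCStarAlgebra R A}.

Definition apos (R : realType) (A : cstarAlgType R) (a : A) : Prop :=
  exists b : A, a = amul (astar b) b.

(* A right Hilbert A-module, with inner product linear in the second variable.
   Definiteness of the inner product is contained in [inner_norm]. *)
HB.mixin Record isHilbertModule (R : realType) (A : cstarAlgType R) H
    of CompleteNormedModule R[i] H := {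
  ract : H -> A -> H;
  ractDl : forall x y a, ract (x + y) a = ract x a + ract y a;
  ractDr : forall x a b, ract x (a + b) = ract x a + ract x b;
  ractA : forall x a b, ract x (amul a b) = ract (ract x a) b;
  ractZl : forall (k : R[i]) x a, ract (k *: x) a = k *: ract x a;
  ractZr : forall (k : R[i]) x a, ract x (k *: a) = k *: ract x a;
  inner : H -> H -> A;
  innerDr : forall x y z, inner x (y + z) = inner x y + inner x z;
  innerZr : forall (k : R[i]) x y, inner x (k *: y) = k *: inner x y;
  inner_ract : forall x y a, inner x (ract y a) = amul (inner x y) a;
  inner_star : forall x y, astar (inner x y) = inner y x;
  inner_pos : forall x, apos (inner x x);
  inner_norm : forall x, `|x| ^+ 2 = `|inner x x|
}.

#[short(type="hilbertModType")]
HB.structure Definition HilbertModule (R : realType) (A : cstarAlgType R) :=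
  {H of CompleteNormedModule R[i] H & isHilbertModule R A H}.

Section InnerTheory.
Context {R : realType} {A : cstarAlgType R} {H : hilbertModType A}.
Implicit Types (x y z : H) (k : R[i]).

Lemma astar0 : astar (0 : A) = 0.
Proof. by apply: (addIr (astar 0)); rewrite -astarD !add0r. Qed.

Lemma innerDl x y z : inner (x + y) z = inner x z + inner y z.
Proof. by rewrite -inner_star innerDr astarD !inner_star. Qed.

Lemma innerZl k x y : inner (k *: x) y = Num.conj k *: inner x y.
Proof. by rewrite -inner_star innerZr astarZ inner_star. Qed.

Lemma inner0r x : inner x (0 : H) = 0.
Proof. by rewrite -[0 in LHS](scale0r (0 : H)) innerZr scale0r. Qed.

Lemma inner0l x : inner (0 : H) x = 0.
Proof. by rewrite -inner_star inner0r astar0. Qed.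

Lemma innerNr x y : inner x (- y) = - inner x y.
Proof. by rewrite -scaleN1r innerZr scaleN1r. Qed.

Lemma innerNl x y : inner (- x) y = - inner x y.
Proof. by rewrite -scaleN1r innerZl rmorphN1 scaleN1r. Qed.

Lemma inner_eq0 x : inner x x = 0 -> x = 0.
Proof.
move=> x0; apply/eqP.
by rewrite -normr_eq0 -sqrf_eq0 inner_norm x0 normr0.
Qed.

Lemma inner_injl x y : (forall z, inner x z = inner y z) -> x = y.
Proof.
move=> xy; apply/subr0_eq/inner_eq0.
by rewrite innerDl innerNl xy subrr.
Qed.

Lemma inner_injr x y : (forall z, inner z x = inner z y) -> x = y.
Proof.
by move=> xy; apply: inner_injl => z; rewrite -inner_star xy inner_star.
Qed.
End InnerTheory.

(* L(H). The adjoint is carried along; it is determined by the operator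
   (see [adjop_ext]), and linearity and boundedness follow from [opP]. *)
Record adjop (R : realType) (A : cstarAlgType R) (H : hilbertModType A) :=
  AdjOp {
    op :> H -> H;
    opadj : H -> H;
    opP : forall x y : H, inner (op x) y = inner x (opadj y)
  }.

Section AdjOp.
Context {R : realType} {A : cstarAlgType R} {H : hilbertModType A}.
Implicit Types S T U : adjop H.

Lemma adjop_ext S T : S =1 T -> S = T.
Proof.
case: S T => [s s' sP] [t t' tP] /= /funext st; subst t.
have s't' : s' = t'.
  by apply/funext => y; apply: inner_injr => x; rewrite -sP -tP.
by subst t'; rewrite (Prop_irrelevance sP tP).
Qed.

Lemma adjP T x y : inner (opadj T x) y = inner x (T y).
Proof. by rewrite -inner_star -opP inner_star. Qed.

Definition adj T : adjop H := AdjOp (adjP T).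

Lemma adjop0_subproof (x y : H) : inner (0 : H) y = inner x (0 : H).
Proof. by rewrite inner0l inner0r. Qed.
Definition adjop0 : adjop H := AdjOp adjop0_subproof.

Lemma adjop1_subproof (x y : H) : inner (idfun x) y = inner x (idfun y).
Proof. by []. Qed.
Definition adjop1 : adjop H := AdjOp adjop1_subproof.

Lemma adjopD_subproof S T x y :
  inner (S x + T x) y = inner x (opadj S y + opadj T y).
Proof. by rewrite innerDl innerDr !opP. Qed.
Definition adjopD S T : adjop H := AdjOp (adjopD_subproof S T).

Lemma adjopN_subproof T x y : inner (- T x) y = inner x (- opadj T y).
Proof. by rewrite innerNl innerNr opP. Qed.
Definition adjopN T : adjop H := AdjOp (adjopN_subproof T).

Lemma adjopM_subproof S T x y :
  inner (S (T x)) y = inner x (opadj T (opadj S y)).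
Proof. by rewrite !opP. Qed.
Definition adjopM S T : adjop H := AdjOp (adjopM_subproof S T).

Lemma adjopZ_subproof (k : R[i]) T x y :
  inner (k *: T x) y = inner x (Num.conj k *: opadj T y).
Proof. by rewrite innerZl innerZr opP. Qed.
Definition adjopZ (k : R[i]) T : adjop H := AdjOp (adjopZ_subproof k T).

Lemma opD T (x y : H) : T (x + y) = T x + T y.
Proof. by apply: inner_injl => z; rewrite !(innerDl, opP). Qed.

Lemma opZ T (k : R[i]) (x : H) : T (k *: x) = k *: T x.
Proof. by apply: inner_injl => z; rewrite !(innerZl, opP). Qed.

HB.instance Definition _ := gen_eqMixin (adjop H).
HB.instance Definition _ := gen_choiceMixin (adjop H).

Lemma adjop_addA : associative adjopD.
Proof. by move=> S T U; apply: adjop_ext => x /=; rewrite addrA. Qed.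
Lemma adjop_addC : commutative adjopD.
Proof. by move=> S T; apply: adjop_ext => x /=; rewrite addrC. Qed.
Lemma adjop_add0 : left_id adjop0 adjopD.
Proof. by move=> S; apply: adjop_ext => x /=; rewrite add0r. Qed.
Lemma adjop_addN : left_inverse adjop0 adjopN adjopD.
Proof. by move=> S; apply: adjop_ext => x /=; rewrite addNr. Qed.
HB.instance Definition _ :=
  GRing.isZmodule.Build (adjop H) adjop_addA adjop_addC adjop_add0 adjop_addN.

Lemma adjop_mulA : associative adjopM.
Proof. by move=> S T U; apply: adjop_ext. Qed.
Lemma adjop_mul1l : left_id adjop1 adjopM.
Proof. by move=> S; apply: adjop_ext. Qed.
Lemma adjop_mul1r : right_id adjop1 adjopM.
Proof. by move=> S; apply: adjop_ext. Qed.
Lemma adjop_mulDl : left_distributive adjopM +%R.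
Proof. by move=> S T U; apply: adjop_ext. Qed.
Lemma adjop_mulDr : right_distributive adjopM +%R.
Proof. by move=> S T U; apply: adjop_ext => x /=; rewrite opD. Qed.
HB.instance Definition _ := GRing.Zmodule_isPzRing.Build (adjop H)
  adjop_mulA adjop_mul1l adjop_mul1r adjop_mulDl adjop_mulDr.

Lemma adjop_scaleA (a b : R[i]) T : adjopZ a (adjopZ b T) = adjopZ (a * b) T.
Proof. by apply: adjop_ext => x /=; rewrite scalerA. Qed.
Lemma adjop_scale1 : left_id 1 adjopZ.
Proof. by move=> T; apply: adjop_ext => x /=; rewrite scale1r. Qed.
Lemma adjop_scaleDr : right_distributive adjopZ +%R.
Proof. by move=> k S T; apply: adjop_ext => x /=; rewrite scalerDr. Qed.
Lemma adjop_scaleDl T : {morph adjopZ^~ T : a b / a + b}.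
Proof. by move=> a b; apply: adjop_ext => x /=; rewrite scalerDl. Qed.
HB.instance Definition _ := GRing.Zmodule_isLmodule.Build R[i] (adjop H)
  adjop_scaleA adjop_scale1 adjop_scaleDr adjop_scaleDl.

(* Each operator below is uniquely determined by its defining property; the
   default value 0 of [xget] is taken only when no such operator exists. *)

Definition op_pos T : Prop := exists S, T = adj S * S.

Definition sqrtop T : adjop H := xget 0 [set S | op_pos S /\ S * S = T].

Definition absop T : adjop H := sqrtop (adj T * T).

Definition invop T : adjop H := xget 0 [set S | S * T = 1 /\ T * S = 1].

Definition mpinv T : adjop H :=
  xget 0 [set X | [/\ T * X * T = T, X * T * X = X,
                      adj (T * X) = T * X & adj (X * T) = X * T]].

Definition is_idempotent T : Prop := T * T = T.

Definition is_projection T : Prop := is_idempotent T /\ adj T = T.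

Definition is_partial_isometry U : Prop := is_projection (adj U * U).

Definition ortho (M : set H) : set H :=
  [set y | forall x, M x -> inner x y = 0].

Definition orth_complemented (M : set H) : Prop :=
  [set x + y | x in M & y in ortho M] = setT.

Definition proj_on (M : set H) : adjop H :=
  xget 0 [set P : adjop H | is_projection P /\ range P = M].

Definition has_polar_decomposition T : Prop :=
  orth_complemented (closure (range (adj T))) /\
  exists U, [/\ is_partial_isometry U, T = U * absop T
              & adj U * U = proj_on (closure (range (adj T)))].

Definition quasi_projection_pair (P Q : adjop H) : Prop :=
  [/\ is_projection P, is_idempotent Q,
      P * adj Q * P = P * Q * P,
      P * adj Q * (1 - P) = - (P * Q * (1 - P))
    & (1 - P) * adj Q * (1 - P) = (1 - P) * Q * (1 - P)].

Definition semi_harmonious (P Q : adjop H) : Prop :=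
  [/\ quasi_projection_pair P Q,
      has_polar_decomposition (P * (1 - Q))
    & has_polar_decomposition ((1 - P) * Q)].

Definition matched_projection (Q : adjop H) : adjop H :=
  2^-1 *: ((absop (adj Q) + adj Q) * mpinv (absop (adj Q))
           * invop (absop (adj Q) + 1) * (absop (adj Q) + Q)).

End AdjOp.

(* Main.v *)
Require Import Defs.
From mathcomp Require Import all_boot all_order all_algebra complex.
From mathcomp Require Import all_classical all_reals all_analysis.
From mathcomp Require Import ring lra.
From Stdlib Require Ncring Ncring_tac.

(** Let p be the projection onto the range of Q and t = Q + Q* - 1. Then t is
    self-adjoint, t^2 = 1 + (Q - Q* )* (Q - Q* ) is invertible, Q = p t, and
    p t + t p = 1 + t, so that t^2 commutes with p. Put b = |t|. Since
    |Q*| = b p, the formula for m(Q) collapses to 2 m(Q) = 1 + t / b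
    ([matched_projectionE]): the reflection 2 m(Q) - 1 is the sign of t. It
    conjugates Q into Q*, which is the quasi-projection property.

    With the reflection e = 2 p - 1, the normal operator G = b + t e satisfies
    G* G = G G* = 2 b (1 + b), hence G / |G| is unitary, and a computation gives
      m(Q) (1 - Q) = 1/2 (1 + b)^-1 G (p - Q),
      (1 - m(Q)) Q = 1/2 (1 + b)^-1 G (p - Q)* (e t / b),
    where e t / b is unitary as well. So up to unitaries and an invertible
    positive operator that commutes with p - Q and its adjoint, one corner
    operator is p - Q and the other is its adjoint ([corner_factorization]).
    The existence of a polar decomposition is unaffected by adjunction, by
    unitaries on either side, and by a positive invertible factor that
    commutes with T* T ([polar_adj], [polar_unitary], [polar_mulr]). Hence both
    corner operators have polar decompositions when p - Q has one, and the
    first of them gives back that of p - Q.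

    That absolute values exist and are unique, where positive means of the
    form S* S, is derived from the norm, without ordering the coefficient
    algebra and without spectra. A self-adjoint contraction k satisfies |1 - k^2| <= 1, because
    1 - k^2 has a self-adjoint root s by a power series and k + is is unitary
    ([sa_contraction_sine]). Thus self-adjoint squares are the self-adjoint T
    with |mu - T| <= mu for some mu > 0, a condition stable under sums and
    sufficient for a root. That every S* S is a self-adjoint square reduces to
    showing that c* c = - v^2 forces v = 0. Then c c* is a square w^2, and
    w^2 c = - c v^2; iterating the angle doubling of the sine on v transforms
    w^2 into 4 w^2 (1 + w^2), which grows by a factor of 4 at each step, whereas
    v remains a contraction ([adj_mul_neg_square]). *)

Set Implicit Arguments.
Unset Strict Implicit.
Unset Printing Implicit Defensive.

Import Order.TTheory GRing.Theory Num.Theory.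
Import numFieldNormedType.Exports.

Local Open Scope classical_set_scope.
Local Open Scope ring_scope.
Local Open Scope complex_scope.

(** Gives the normalizer of words in noncommuting variables access to every
    ring, so that identities between operators reduce to their relations. *)
#[local] Instance ncring_ops (R : pzRingType) :
  @Ncring.Ring_ops R 0 1 (@GRing.add R) (@GRing.mul R) (fun x y => x - y)
    (@GRing.opp R) (@eq R) := {}.

#[local] Instance ncring_laws (R : pzRingType) :
  @Ncring.Ring R 0 1 (@GRing.add R) (@GRing.mul R) (fun x y => x - y)
    (@GRing.opp R) (@eq R) (ncring_ops R).
Proof.
split=> //=.
- by split=> // [x y z -> ->].
- by move=> x y -> a b ->.
- by move=> x y -> a b ->.
- by move=> x y -> a b ->.
- by move=> x y ->.
- exact: add0r.
- exact: addrC.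
- exact: addrA.
- exact: mul1r.
- exact: mulr1.
- exact: mulrA.
- exact: mulrDl.
- by move=> x y z; exact: mulrDr.
- exact: subrr.
Qed.

Ltac ncring := Ncring_tac.non_commutative_ring.

(** * The real-valued norm *)

Definition rnorm (R : realType) (V : normedModType R[i]) (x : V) : R :=
  complex.Re `|x|.

Section RealNorm.
Context {R : realType} {V : normedModType R[i]}.
Implicit Types (x y : V) (r : R).

Lemma rnormE x : `|x| = (rnorm x)%:C.
Proof.
rewrite /rnorm; have: 0 <= `|x| by [].
by case: `|x| => a b; rewrite lecE /= => /andP[/eqP -> _].
Qed.

Lemma rnorm_ge0 x : 0 <= rnorm x.
Proof. by rewrite -lecR -rnormE normr_ge0. Qed.

Lemma rnormD x y : rnorm (x + y) <= rnorm x + rnorm y.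
Proof. by rewrite -lecR rmorphD /= -!rnormE; exact: ler_normD. Qed.

Lemma rnormN x : rnorm (- x) = rnorm x.
Proof. by rewrite /rnorm normrN. Qed.

Lemma rnorm0 : rnorm (0 : V) = 0.
Proof. by rewrite /rnorm normr0. Qed.

Lemma rnorm_eq0 x : rnorm x = 0 -> x = 0.
Proof. by move=> x0; apply/eqP; rewrite -normr_eq0 rnormE x0. Qed.

Lemma rnormB x y : rnorm (x - y) <= rnorm x + rnorm y.
Proof. by rewrite -(rnormN y); exact: rnormD. Qed.

Lemma rnormBC x y : rnorm (x - y) = rnorm (y - x).
Proof. by rewrite -opprB rnormN. Qed.

Lemma rnormZ r x : rnorm (r%:C *: x) = `|r| * rnorm x.
Proof.
apply: complexI; rewrite -rnormE normrZ rnormE rmorphM /=; congr (_ * _).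
by rewrite normc_def /= expr0n addr0 sqrtr_sqr.
Qed.

Lemma rnormZi x : rnorm ('i *: x) = rnorm x.
Proof.
apply: complexI; rewrite -rnormE normrZ rnormE.
by rewrite normc_def /= expr0n expr1n add0r sqrtr1 mul1r.
Qed.

End RealNorm.

(** The whole development reaches limits through this quantitative form of
    completeness, with an explicit modulus. *)
Lemma complete_modulus (R : realType) (V : completeNormedModType R[i])
    (u : nat -> V) (e : nat -> R) :
    (forall eps, 0 < eps -> exists n, e n < eps) ->
    (forall n m, (n <= m)%N -> rnorm (u m - u n) <= e n) ->
  exists l, forall n, rnorm (l - u n) <= e n.
Proof.
move=> e0 ue.
have cu : cvgn u.
  apply/cauchy_cvgP/cauchy_exP => eps eps0.
  have [eps1 eps2] : eps = (complex.Re eps)%:C /\ 0 < complex.Re eps.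
    move: eps0; case: (eps) => a b; rewrite ltcE /= => /andP[/eqP -> ?].
    by split.
  have [n en] := e0 _ eps2.
  exists (u n); exists n => // m /= nm.
  rewrite -ball_normE /= rnormE eps1 ltcR rnormBC.
  exact: le_lt_trans (ue _ _ nm) en.
exists (limn u) => n; rewrite leNgt; apply/negP => lt_en.
have d0 : 0 < rnorm (limn u - u n) - e n by rewrite subr_gt0.
have d0' : 0 < (rnorm (limn u - u n) - e n)%:C by rewrite ltcR.
have /cvgrPdist_lt /(_ _ d0') [k _ kP] := cu.
have := kP (maxn n k) (leq_maxr _ _).
rewrite rnormE ltcR => lt1.
have lt2 := ue _ _ (leq_maxl n k).
have := rnormD (limn u - u (maxn n k)) (u (maxn n k) - u n).
rewrite subrKA; lra.
Qed.

Lemma geometric_small (R : realType) (q : R) : 0 <= q < 1 ->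
  forall eps, 0 < eps -> exists n, q ^+ n < eps.
Proof.
move=> /andP[q0 q1] eps eps0.
have /cvgrPdist_lt /(_ _ eps0) : (fun n => q ^+ n) @ \oo --> 0.
  by apply: cvg_expr; rewrite ger0_norm.
case=> N _ /(_ N (leqnn _)); rewrite sub0r normrN ger0_norm ?exprn_ge0 //.
by exists N.
Qed.

Lemma le0_of_modulus (R : realType) (x C : R) (e : nat -> R) :
  (forall eps, 0 < eps -> exists n, e n < eps) -> 0 <= C ->
  (forall n, x <= C * e n) -> x <= 0.
Proof.
move=> e0 C0 xe; rewrite leNgt; apply/negP => x0.
have C1 : 0 < C + 1 by lra.
have [n en] := e0 (x / (C + 1)) (divr_gt0 x0 C1).
have : C * e n < x.
  rewrite ltr_pdivlMr // in en.
  have [e1|e1] := leP 0 (e n); last by apply: le_lt_trans x0; nra.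
  by nra.
by have := xe n; lra.
Qed.

(** * Cauchy-Schwarz up to a constant *)

Section Hilbert.
Context {R : realType} {A : cstarAlgType R} {H : hilbertModType A}.
Implicit Types (x y z : H) (r : R) (S T U X Y Z : adjop H).

Lemma conjR r : Num.conj (r%:C : R[i]) = r%:C.
Proof. exact: conjc_real. Qed.

Lemma conji : Num.conj ('i : R[i]) = - 'i.
Proof. by apply/eqP; rewrite eq_complex /= oppr0 !eqxx. Qed.

Lemma rnorm_inner x : rnorm (inner x x) = rnorm x ^+ 2.
Proof.
by apply: complexI; rewrite -rnormE -inner_norm rnormE rmorphXn.
Qed.

Lemma rnorm_inner_le1 x y : rnorm x <= 1 -> rnorm y <= 1 ->
  rnorm (inner x y) <= 4.
Proof.
move=> x1 y1.
have para u v : inner (u + v) (u + v) - inner (u - v) (u - v) =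
    (inner u v + inner v u) *+ 2 :> A.
  have zm (a b c : A) : (a + b + c) - (a - b + c) = b *+ 2.
    by rewrite opprD addrACA subrr addr0 opprB addrC subrKA -mulr2n.
  rewrite -[RHS](zm (inner u u) _ (inner v v)); congr (_ - _).
    by rewrite innerDl !innerDr !addrA.
  by rewrite innerDl !innerDr !innerNl !innerNr opprK opprD !addrA.
have polar : 4%:C *: inner x y =
    (inner (x + y) (x + y) - inner (x - y) (x - y))
    - 'i *: (inner (x + 'i *: y) (x + 'i *: y)
             - inner (x - 'i *: y) (x - 'i *: y)).
  have ii : 'i * 'i = -1 :> R[i] by rewrite -expr2 sqr_i.
  rewrite !para innerZr innerZl conji -scalerMnr -mulrnBl scalerDr !scalerA.
  rewrite mulrN ii opprK scaleN1r scale1r opprD opprK addrACA subrr addr0.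
  by rewrite -mulr2n -mulrnA (rmorph_nat (real_complex R) 4) scaler_nat.
have sq z : rnorm z <= 2 -> rnorm (inner z z) <= 4.
  by move=> z2; rewrite rnorm_inner; have := rnorm_ge0 z; nra.
have n1 : rnorm ('i *: y) <= 1 by rewrite rnormZi.
have s1 : rnorm (inner (x + y) (x + y)) <= 4.
  by apply: sq; have := rnormD x y; lra.
have s2 : rnorm (inner (x - y) (x - y)) <= 4.
  by apply: sq; have := rnormB x y; lra.
have s3 : rnorm (inner (x + 'i *: y) (x + 'i *: y)) <= 4.
  by apply: sq; have := rnormD x ('i *: y); lra.
have s4 : rnorm (inner (x - 'i *: y) (x - 'i *: y)) <= 4.
  by apply: sq; have := rnormB x ('i *: y); lra.
have : rnorm (4%:C *: inner x y) <= 16.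
  rewrite polar; apply: le_trans (rnormB _ _) _; rewrite rnormZi.
  have := rnormB (inner (x + y) (x + y)) (inner (x - y) (x - y)).
  have := rnormB (inner (x + 'i *: y) (x + 'i *: y))
                 (inner (x - 'i *: y) (x - 'i *: y)).
  lra.
by rewrite rnormZ ger0_norm; lra.
Qed.

(** Cauchy-Schwarz up to a constant. The sharp inequality needs the order on
    [A]; polarization and the triangle inequality suffice for this one. *)
Lemma rnorm_inner_le x y : rnorm (inner x y) <= 4 * rnorm x * rnorm y.
Proof.
have [x0|x0] := eqVneq (rnorm x) 0.
  by rewrite (rnorm_eq0 x0) inner0l !rnorm0 mulr0 mul0r.
have [y0|y0] := eqVneq (rnorm y) 0.
  by rewrite (rnorm_eq0 y0) inner0r !rnorm0 mulr0.
have xp : 0 < rnorm x by rewrite lt_def x0 rnorm_ge0.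
have yp : 0 < rnorm y by rewrite lt_def y0 rnorm_ge0.
have := @rnorm_inner_le1 ((rnorm x)^-1%:C *: x) ((rnorm y)^-1%:C *: y).
rewrite innerZl innerZr conjR !rnormZ !gtr0_norm ?invr_gt0 // !mulVf //.
move=> /(_ (lexx _) (lexx _)); rewrite mulrA -invfM.
by rewrite mulrC ler_pdivrMr ?mulr_gt0 // mulrA.
Qed.

(** * Boundedness of adjointable operators *)

Definition opbound (T : adjop H) (k : R) :=
  forall x : H, rnorm (T x) <= k * rnorm x.

(** Uniform boundedness, by a gliding hump: if T is unbounded, unit vectors
    x_n with huge images w_n are found, and a vector z is built by adding or
    subtracting at step n a multiple of w_n of norm 9^-n, so that the inner
    product of w_n and z is large for each n; but it is also the inner
    product of x_n and the adjoint of T at z, which stays bounded. *)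
Lemma adjop_bounded T : exists2 k, 0 <= k & opbound T k.
Proof.
apply: contrapT => nT.
have unb k : 0 <= k -> exists x, rnorm x = 1 /\ k < rnorm (T x).
  move=> k0; apply: contrapT => nx; apply: nT; exists k => // x.
  have [x0|x0] := eqVneq (rnorm x) 0.
    by rewrite x0 (rnorm_eq0 x0) -(scale0r (0 : H)) opZ scale0r rnorm0 mulr0.
  have xp : 0 < rnorm x by rewrite lt_def x0 rnorm_ge0.
  rewrite leNgt; apply/negP => lt; apply: nx.
  exists ((rnorm x)^-1%:C *: x); rewrite opZ !rnormZ !gtr0_norm ?invr_gt0 //.
  by rewrite mulVf // ltr_pdivlMl // mulrC.
pose q n : R := 9^-1 ^+ n.
have q0 n : 0 < q n by rewrite /q exprn_gt0 // invr_gt0.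
have qS n : q n = 9 * q n.+1 by rewrite /q exprS mulrA divff ?mul1r.
have kn0 n : 0 <= n%:R / q n by rewrite divr_ge0 // ltW.
pose xs n := sval (cid (unb _ (kn0 n))).
have xs1 n : rnorm (xs n) = 1 by rewrite /xs; case: cid => ? [].
pose w n := T (xs n).
have wn n : n%:R / q n < rnorm (w n) by rewrite /w /xs; case: cid => ? [].
have w0 n : 0 < rnorm (w n) by exact: le_lt_trans (wn n).
pose v n := (q n / rnorm (w n))%:C *: w n.
have vn n : rnorm (v n) = q n.
  by rewrite rnormZ gtr0_norm ?divr_gt0 // divfK // gt_eqF.
pose phi n z := rnorm (inner (w n) z).
have phiv n : phi n (v n) = q n * rnorm (w n).
  rewrite /phi innerZr rnormZ rnorm_inner gtr0_norm ?divr_gt0 // expr2 mulrA.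
  by rewrite divfK // gt_eqF.
(* the sign of the n-th hump is chosen so as not to cancel what precedes *)
pose fix z n := if n is m.+1 then
    if q m * rnorm (w m) <= phi m (z m + v m) then z m + v m else z m - v m
  else 0.
have zS n : q n * rnorm (w n) <= phi n (z n.+1).
  rewrite /=; case: ifP => // /negbT; rewrite -ltNge => lt1.
  have : 2 * phi n (v n) <= phi n (z n + v n) + phi n (z n - v n).
    rewrite /phi; apply: le_trans (rnormB _ _); rewrite -innerNr -innerDr.
    have -> : z n + v n - (z n - v n) = 2%:C *: v n.
      rewrite opprB addrC subrKA -mulr2n.
      by rewrite (rmorph_nat (real_complex R)) scaler_nat.
    by rewrite [in leRHS]innerZr rnormZ [`|2|]ger0_norm.
  by rewrite phiv; lra.
have dz n : rnorm (z n.+1 - z n) <= q n.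
  rewrite /=; case: ifP => _; first by rewrite addrC addKr vn.
  by rewrite addrC addKr rnormN vn.
have dzd n d : rnorm (z (n + d)%N - z n) <= 9 / 8 * (q n - q (n + d)%N).
  elim: d => [|d IH]; first by rewrite addn0 !subrr rnorm0 mulr0.
  rewrite addnS; have := dz (n + d)%N; have := qS (n + d)%N.
  have := rnormD (z (n + d).+1 - z (n + d)%N) (z (n + d)%N - z n).
  by rewrite subrKA; lra.
have [l lP] : exists l, forall n, rnorm (l - z n) <= 9 / 8 * q n.
  apply: complete_modulus => [eps eps0|n m nm]; last first.
    by have := dzd n (m - n)%N; rewrite subnKC // ; have := q0 m; lra.
  have q01 : 0 <= (9^-1 : R) < 1 by rewrite invr_ge0 invf_lt1 ?ler0n ?ltr1n.
  have eps2 : 0 < eps / 2 by lra.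
  have [N] := geometric_small q01 eps2; rewrite -/(q N) => qN.
  by exists N; have := q0 N; lra.
pose M := 4 * rnorm (opadj T l).
have phil n : n%:R / 2 <= M.
  have h1 : phi n l <= M.
    rewrite /phi /w opP; apply: le_trans (rnorm_inner_le _ _) _.
    by rewrite xs1 mulr1.
  have h2 : phi n (l - z n.+1) <= q n * rnorm (w n) / 2.
    apply: le_trans (rnorm_inner_le _ _) _.
    have := lP n.+1; have := qS n; have := w0 n; nra.
  have h3 : phi n (z n.+1) <= phi n l + phi n (l - z n.+1).
    rewrite /phi; apply: le_trans (rnormB _ _); rewrite -innerNr -innerDr.
    by rewrite opprB addrC subrK.
  have h4 : n%:R <= q n * rnorm (w n).
    by have := wn n; rewrite ltr_pdivrMr // mulrC => /ltW.
  have := zS n; lra.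
have := phil (Num.truncn (2 * M)).+1.
have := truncnS_gt (2 * M); lra.
Qed.
End Hilbert.

(** * The *-algebra of adjointable operators *)

Section Star.
Context {R : realType} {A : cstarAlgType R} {H : hilbertModType A}.
Implicit Types (x y z : H) (r k : R) (S T U X Y Z : adjop H).

Lemma opB T x y : T (x - y) = T x - T y.
Proof. by rewrite opD -scaleN1r opZ scaleN1r. Qed.

Lemma adj_adj T : adj (adj T) = T.
Proof. exact: adjop_ext. Qed.

Lemma adj_mul S T : adj (S * T) = adj T * adj S.
Proof. exact: adjop_ext. Qed.

Lemma adj_add S T : adj (S + T) = adj S + adj T.
Proof. exact: adjop_ext. Qed.

Lemma adj_sub S T : adj (S - T) = adj S - adj T.
Proof. exact: adjop_ext. Qed.

Lemma adj_one : adj (1 : adjop H) = 1.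
Proof. exact: adjop_ext. Qed.

Lemma adj_zero : adj (0 : adjop H) = 0.
Proof. exact: adjop_ext. Qed.

Lemma adj_scale (c : R[i]) T : adj (c *: T) = Num.conj c *: adj T.
Proof. exact: adjop_ext. Qed.

Lemma scaleAl (c : R[i]) S T : c *: (S * T) = (c *: S) * T.
Proof. exact: adjop_ext. Qed.

Lemma scaleAr (c : R[i]) S T : c *: (S * T) = S * (c *: T).
Proof. by apply: adjop_ext => x /=; rewrite opZ. Qed.

Lemma half_scale T : 2^-1%:C *: T + 2^-1%:C *: T = T.
Proof.
rewrite -scalerDl -rmorphD /= (_ : 2^-1 + 2^-1 = 1) ?scale1r //.
by lra.
Qed.

(** Definiteness of the inner product stands in for the C*-identity of
    operators. *)
Lemma adj_mul_eq0 T : adj T * T = 0 -> T = 0.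
Proof.
move=> T0; apply: adjop_ext => x; apply: inner_eq0.
by rewrite opP -[opadj T _]/((adj T * T) x) T0 inner0r.
Qed.

Lemma isometry_rnorm U x : adj U * U = 1 -> rnorm (U x) = rnorm x.
Proof.
move=> U1; apply: (@pexpIrn _ 2) => //; rewrite ?nnegrE ?rnorm_ge0 //.
by rewrite -!rnorm_inner opP -[opadj U _]/((adj U * U) x) U1.
Qed.

Lemma isometry_mul U V : adj U * U = 1 -> adj V * V = 1 ->
  adj (U * V) * (U * V) = 1.
Proof. by move=> U1 V1; rewrite adj_mul -mulrA (mulrA (adj U)) U1 mul1r. Qed.

(** ** Operator bounds *)

Lemma opboundD S T a b : opbound S a -> opbound T b -> opbound (S + T) (a + b).
Proof.
move=> Sa Tb x; apply: le_trans (rnormD _ _) _.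
by rewrite mulrDl lerD.
Qed.

Lemma opboundN T a : opbound T a -> opbound (- T) a.
Proof. by move=> Ta x; rewrite /= rnormN. Qed.

Lemma opboundB S T a b : opbound S a -> opbound T b -> opbound (S - T) (a + b).
Proof. by move=> Sa Tb; apply: opboundD => //; exact: opboundN. Qed.

Lemma opboundM S T a b : 0 <= a ->
  opbound S a -> opbound T b -> opbound (S * T) (a * b).
Proof.
move=> a0 Sa Tb x; apply: le_trans (Sa _) _.
by rewrite -mulrA ler_wpM2l.
Qed.

Lemma opboundZ r T a : opbound T a -> opbound (r%:C *: T) (`|r| * a).
Proof. by move=> Ta x; rewrite /= rnormZ -mulrA ler_wpM2l. Qed.

Lemma opbound1 : opbound (1 : adjop H) 1.
Proof. by move=> x; rewrite mul1r. Qed.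

Lemma opbound0 : opbound (0 : adjop H) 0.
Proof. by move=> x; rewrite /= rnorm0 mul0r. Qed.

Lemma opbound_le T a b : a <= b -> opbound T a -> opbound T b.
Proof. by move=> ab Ta x; apply: le_trans (Ta x) _; rewrite ler_wpM2r ?rnorm_ge0. Qed.

Lemma isometry_opbound U : adj U * U = 1 -> opbound U 1.
Proof. by move=> U1 x; rewrite isometry_rnorm // mul1r. Qed.

Lemma op_eq0 T C (e : nat -> R) :
  (forall eps, 0 < eps -> exists n, e n < eps) -> 0 <= C ->
  (forall n, opbound T (C * e n)) -> T = 0.
Proof.
move=> e0 C0 Te; apply: adjop_ext => x; apply: rnorm_eq0; apply/eqP.
rewrite eq_le rnorm_ge0 andbT.
apply: (le0_of_modulus e0 (mulr_ge0 C0 (rnorm_ge0 x))) => n.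
by rewrite mulrAC; exact: Te.
Qed.

(** For self-adjoint terms the pointwise limit is its own adjoint, so it is
    adjointable without a separate limit of adjoints. The last clause makes
    roots and inverses commute with the commutant of the given operator. *)
Lemma selfadj_limit (Y : nat -> adjop H) (e : nat -> R) :
  (forall eps, 0 < eps -> exists n, e n < eps) -> (forall n, 0 <= e n) ->
  (forall n, adj (Y n) = Y n) ->
  (forall n m, (n <= m)%N -> opbound (Y m - Y n) (e n)) ->
  exists L, [/\ adj L = L, forall n, opbound (L - Y n) (e n)
    & forall Z, (forall n, Z * Y n = Y n * Z) -> Z * L = L * Z].
Proof.
move=> e0 e_ge0 Ysa Ye.
have lim_ex x : exists l, forall n, rnorm (l - Y n x) <= e n * rnorm x.
  apply: (@complete_modulus _ _ (fun n => Y n x) (fun n => e n * rnorm x)).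
    move=> eps eps0; have xp : 0 < rnorm x + 1 by have := rnorm_ge0 x; lra.
    have [n] := e0 _ (divr_gt0 eps0 xp); rewrite ltr_pdivlMr // => en.
    by exists n; apply: le_lt_trans en; rewrite ler_wpM2l // lerDl.
  by move=> n m nm; exact: Ye.
pose L x := sval (cid (lim_ex x)).
have LP x n : rnorm (L x - Y n x) <= e n * rnorm x.
  by rewrite /L; case: cid.
have Lsa x y : inner (L x) y = inner x (L y).
  apply/eqP; rewrite -subr_eq0; apply/eqP/rnorm_eq0/eqP.
  rewrite eq_le rnorm_ge0 andbT.
  have C0 : 0 <= 8 * (rnorm x * rnorm y) by rewrite !mulr_ge0 ?rnorm_ge0.
  apply: (le0_of_modulus e0 C0) => n.
  have -> : inner (L x) y - inner x (L y) =
      inner (L x - Y n x) y - inner x (L y - Y n y).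
    have Yn : inner (Y n x) y = inner x (Y n y) by rewrite opP -{2}(Ysa n).
    rewrite innerDl innerDr innerNl innerNr Yn opprD opprK addrACA.
    by rewrite addNr addr0.
  apply: le_trans (rnormB _ _) _.
  have h1 := rnorm_inner_le (L x - Y n x) y.
  have h2 := rnorm_inner_le x (L y - Y n y).
  have h3 := LP x n; have h4 := LP y n.
  have := rnorm_ge0 x; have := rnorm_ge0 y; nra.
exists (AdjOp Lsa); split; [exact: adjop_ext | by move=> n x; exact: LP |].
move=> Z ZY; have [M M0 ZM] := adjop_bounded Z.
have M20 : 0 <= 2 * M by lra.
apply/subr0_eq; apply: (op_eq0 e0 M20) => n.
have -> : Z * AdjOp Lsa - AdjOp Lsa * Z =
    Z * (AdjOp Lsa - Y n) - (AdjOp Lsa - Y n) * Z.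
  rewrite mulrBr mulrBl ZY opprB addrA subrK.
  by [].
have LYn : opbound (AdjOp Lsa - Y n) (e n) by move=> x; exact: LP.
rewrite (_ : _ * _ = M * e n + e n * M); last by ring.
by apply: opboundB; apply: opboundM.
Qed.

End Star.

(** * Square roots *)

(** The numerical companion of [root_iter], at X = 1. *)
Fixpoint root_rate (R : realType) n : R :=
  if n is m.+1 then (1 + root_rate R m ^+ 2) / 2 else 0.

Lemma root_rate_itv (R : realType) n : 0 <= root_rate R n <= 1.
Proof. by elim: n => [|n IH] /=; [rewrite lexx ler01 | nra]. Qed.

(** The gap d = 1 - t evolves by d - d^2 / 2, which preserves this bound. *)
Lemma root_rate_ge (R : realType) n : 1 - root_rate R n <= 2 / n.+2%:R.
Proof.
elim: n => [|n IH]; first by rewrite /= subr0 divff ?pnatr_eq0.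
have t01 := root_rate_itv R n.
rewrite /= ler_pdivlMr ?ltr0n //.
rewrite ler_pdivlMr ?ltr0n // in IH.
move: IH; set t := root_rate R n in t01 *.
rewrite -(natr1 n.+2) -(natr1 n.+1) -(natr1 n).
have := ler0n R n; set a := n%:R => a0 IH.
have d0 : 0 <= 1 - t <= 1 by lra.
have : 0 <= (2 - (1 - t) * (a + 2)) by lra.
nra.
Qed.

Lemma root_rate_small (R : realType) eps : 0 < eps ->
  exists n, 1 - root_rate R n < eps.
Proof.
move=> eps0; exists (Num.truncn (2 / eps)).
apply: le_lt_trans (root_rate_ge _ _) _.
rewrite ltr_pdivrMr ?ltr0n // mulrC -ltr_pdivrMr //.
by apply: lt_le_trans (truncnS_gt _) _; rewrite ler_nat.
Qed.

Lemma root_rate_mono (R : realType) n m : (n <= m)%N ->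
  root_rate R n <= root_rate R m.
Proof.
move/subnKC <-; elim: (m - n)%N => [|d IH]; first by rewrite addn0.
rewrite addnS; apply: le_trans IH _ => /=.
by have := root_rate_itv R (n + d); nra.
Qed.

Section Roots.
Context {R : realType} {A : cstarAlgType R} {H : hilbertModType A}.
Implicit Types (x y z : H) (r k : R) (S T U X Y Z : adjop H).

Fixpoint root_iter X n : adjop H :=
  if n is m.+1 then 2^-1%:C *: (X + root_iter X m * root_iter X m) else 0.

Lemma root_iter_sa X n : adj X = X -> adj (root_iter X n) = root_iter X n.
Proof.
move=> Xsa; elim: n => [|n IH] /=; first exact: adj_zero.
by rewrite adj_scale conjR adj_add adj_mul Xsa IH.
Qed.

Lemma root_iter_comm X Z n : Z * X = X * Z ->
  Z * root_iter X n = root_iter X n * Z.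
Proof.
move=> ZX; elim: n => [|n IH] /=; first by rewrite mul0r mulr0.
rewrite -scaleAr -scaleAl mulrDr mulrDl ZX; congr (_ *: (_ + _)).
by rewrite mulrA IH -mulrA IH mulrA.
Qed.

Lemma root_iter_bound X n : opbound X 1 ->
  opbound (root_iter X n) (root_rate R n).
Proof.
move=> X1; elim: n => [|n IH] /=; first exact: opbound0.
have /andP[t0 _] := root_rate_itv R n.
have := opboundZ 2^-1 (opboundD X1 (opboundM t0 IH IH)).
by rewrite ger0_norm ?invr_ge0 // mulrC -expr2.
Qed.

Lemma root_iter_step X n : opbound X 1 ->
  opbound (root_iter X n.+1 - root_iter X n)
          (root_rate R n.+1 - root_rate R n).
Proof.
move=> X1; elim: n => [|n IH].
  have := opboundZ 2^-1 X1; rewrite ger0_norm ?invr_ge0 // mulr1.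
  by rewrite /= mul0r addr0 subr0 expr0n addr0 mul1r subr0.
have -> : root_iter X n.+2 - root_iter X n.+1 =
    2^-1%:C *: ((root_iter X n.+1 - root_iter X n) * root_iter X n.+1
                + root_iter X n * (root_iter X n.+1 - root_iter X n)).
  rewrite -[root_iter X n.+2]/(2^-1%:C *: (X + root_iter X n.+1 * root_iter X n.+1)).
  rewrite -{3}[root_iter X n.+1]/(2^-1%:C *: (X + root_iter X n * root_iter X n)).
  by rewrite -scalerBr; congr (_ *: _); ncring.
have t1 := root_rate_itv R n; have t2 := root_rate_itv R n.+1.
have tt := root_rate_mono R (leqnSn n).
have b1 := root_iter_bound n X1; have b2 := root_iter_bound n.+1 X1.
have [t10 _] := andP t1.
have dt0 : 0 <= root_rate R n.+1 - root_rate R n by rewrite subr_ge0.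
have h1 := opboundM dt0 IH b2.
have h2 := opboundM t10 b1 IH.
apply: opbound_le (opboundZ 2^-1 (opboundD h1 h2)).
rewrite ger0_norm ?invr_ge0 //.
rewrite -[root_rate R n.+2]/((1 + root_rate R n.+1 ^+ 2) / 2).
rewrite -{5}[root_rate R n.+1]/((1 + root_rate R n ^+ 2) / 2).
set a := root_rate R n.+1; set b := root_rate R n.
by rewrite le_eqVlt; apply/orP; left; apply/eqP; field.
Qed.

(** The square root of 1 - X as 1 - y, where y = (X + y^2)/2. The iterates
    are polynomials in X with nonnegative coefficients, so their increments
    are bounded by those of the same iteration run on the number 1. *)
Lemma sqrt_1B X : adj X = X -> opbound X 1 ->
  exists y : adjop H, [/\ adj y = y, opbound y 1, (1 - y) * (1 - y) = 1 - X
    & forall Z, Z * X = X * Z -> Z * y = y * Z].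
Proof.
move=> Xsa X1.
have Ye n m : (n <= m)%N ->
    opbound (root_iter X m - root_iter X n) (1 - root_rate R n).
  move=> nm; apply: (@opbound_le _ _ _ _ (root_rate R m - root_rate R n)).
    by have := root_rate_itv R m; lra.
  move/subnKC: nm => <-; elim: (m - n)%N => [|d IH].
    by rewrite addn0 !subrr; exact: opbound0.
  have := opboundD (root_iter_step (n + d) X1) IH.
  by rewrite !subrKA addnS.
have rate0 n : 0 <= 1 - root_rate R n by have := root_rate_itv R n; lra.
have [y [ysa yY yZ]] := selfadj_limit (@root_rate_small R) rate0
  (fun n => root_iter_sa n Xsa) Ye.
have y1 : opbound y 1.
  by have := yY 0; rewrite /= !subr0.
exists y; split=> //; last first.
  by move=> Z ZX; apply: yZ => n; exact: root_iter_comm.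
apply/subr0_eq; apply: (op_eq0 (@root_rate_small R) (ler0n _ 4)) => n.
have -> : (1 - y) * (1 - y) - (1 - X) =
    ((y - root_iter X n) * y + root_iter X n * (y - root_iter X n))
    - ((y - root_iter X n.+1) + (y - root_iter X n.+1)).
  have := half_scale (X + root_iter X n * root_iter X n).
  rewrite -/(root_iter X n.+1); set a := root_iter X n.+1.
  set b := root_iter X n => aa.
  have -> : X = a + a - b * b by rewrite aa; ncring.
  by ncring.
have t1 := root_rate_itv R n.
have h1 := opboundM (rate0 n) (yY n) y1.
have [t10 _] := andP t1.
have h2 := opboundM t10 (root_iter_bound n X1) (yY n).
apply: opbound_le (opboundB (opboundD h1 h2) (opboundD (yY n.+1) (yY n.+1))).
have := root_rate_mono R (leqnSn n).
nra.
Qed.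

(** For a self-adjoint contraction k, with s the root of 1 - k^2, the operator
    k + is is unitary; s and 2ks are the imaginary parts of it and of its
    square, hence contractions. This replaces spectral theory: 1 - k^2 = s^2
    is bounded by 1. *)
Lemma sa_contraction_sine (k : adjop H) : adj k = k -> opbound k 1 ->
  exists s : adjop H, [/\ adj s = s, s * s = 1 - k * k,
    forall Z, Z * (k * k) = (k * k) * Z -> Z * s = s * Z,
    opbound s 1 & opbound (k * s + k * s) 1].
Proof.
move=> ksa k1.
have kk1 : opbound (k * k) 1 by rewrite -(mulr1 1); apply: opboundM.
have kksa : adj (k * k) = k * k by rewrite adj_mul ksa.
have [y [ysa _ yy yZ]] := sqrt_1B kksa kk1.
pose s := 1 - y.
have ssa : adj s = s by rewrite adj_sub adj_one ysa.
have sZ Z : Z * (k * k) = (k * k) * Z -> Z * s = s * Z.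
  by move=> /yZ Zy; rewrite mulrBr mulrBl mulr1 mul1r Zy.
have ss : s * s = 1 - k * k by [].
have ks : k * s = s * k by apply: sZ; rewrite mulrA.
pose I : adjop H := 'i *: (1 : adjop H).
have Isa : adj I = - I by rewrite adj_scale conji adj_one scaleNr.
have II : I * I = - 1 by rewrite -scaleAl mul1r scalerA -expr2 sqr_i scaleN1r.
have IC T : I * T = T * I by rewrite -scaleAl -scaleAr mul1r mulr1.
have iE T : I * T = 'i *: T by rewrite -scaleAl mul1r.
pose W := I * s.
have Wsa : adj W = - W by rewrite adj_mul ssa Isa mulrN -IC.
have kW : k * W = W * k by rewrite /W mulrA -IC -!mulrA ks.
have WW : W * W = - (s * s).
  by rewrite /W mulrA -[_ * s * I]mulrA -IC mulrA II mulN1r mulNr.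
have circle : k * k + s * s = 1 by rewrite ss addrC subrK.
have uu : (k - W) * (k + W) = 1.
  have -> : (k - W) * (k + W) = k * k + (k * W - W * k) - W * W by ncring.
  by rewrite kW subrr addr0 WW opprK.
have uu' : (k + W) * (k - W) = 1.
  have -> : (k + W) * (k - W) = k * k - (k * W - W * k) - W * W by ncring.
  by rewrite kW subrr subr0 WW opprK.
have half T : opbound (I * T + I * T) 2 -> opbound T 1.
  move=> T2 x; have := T2 x.
  rewrite /= -[X in rnorm X <= _]/(I (T x) + I (T x)) -mulr2n -scaler_nat.
  rewrite -(rmorph_nat (real_complex R)) rnormZ ger0_norm ?ler0n //.
  by rewrite rnormZi => ?; lra.
have u_iso : adj (k + W) * (k + W) = 1 by rewrite adj_add ksa Wsa.
have v_iso : adj (k - W) * (k - W) = 1 by rewrite adj_sub ksa Wsa opprK.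
have u2_iso : adj ((k + W) * (k + W)) * ((k + W) * (k + W)) = 1.
  exact: isometry_mul.
have v2_iso : adj ((k - W) * (k - W)) * ((k - W) * (k - W)) = 1.
  exact: isometry_mul.
exists s; split=> //; apply: half.
  rewrite (_ : _ + _ = (k + W) - (k - W)); last by rewrite -/W; ncring.
  exact: opboundB (isometry_opbound u_iso) (isometry_opbound v_iso).
rewrite (_ : _ + _ = (k + W) * (k + W) - (k - W) * (k - W)).
  exact: opboundB (isometry_opbound u2_iso) (isometry_opbound v2_iso).
have -> : (k + W) * (k + W) - (k - W) * (k - W) = (k * W + W * k) + (k * W + W * k).
  by ncring.
have kI : k * W = I * (k * s) by rewrite /W mulrA -IC mulrA.
by rewrite -kW kI; ncring.
Qed.
End Roots.

(** * Positivity *)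

Section Positive.
Context {R : realType} {A : cstarAlgType R} {H : hilbertModType A}.
Implicit Types (x y z : H) (r mu : R) (S T U X Y Z c k v w : adjop H).

(** The spectral form of positivity; [op_pos_square] identifies it with the
    algebraic one. *)
Definition sa_square T := exists2 k, adj k = k & T = k * k.

Lemma sa_square_sa T : sa_square T -> adj T = T.
Proof. by case=> k ksa ->; rewrite adj_mul ksa. Qed.

Lemma sa_scale r T : adj T = T -> adj (r%:C *: T) = r%:C *: T.
Proof. by move=> Tsa; rewrite adj_scale conjR Tsa. Qed.

Lemma scaleM2 r T S : (r%:C *: T) * (r%:C *: S) = (r ^+ 2)%:C *: (T * S).
Proof. by rewrite -scaleAr -scaleAl scalerA expr2 rmorphM. Qed.

Lemma rescale_contraction T : exists2 r : R, 0 < r & opbound (r%:C *: T) 1.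
Proof.
have [M M0 TM] := adjop_bounded T; exists (M + 1)^-1.
  by rewrite invr_gt0; lra.
apply: opbound_le (opboundZ _ TM).
by rewrite ger0_norm ?invr_ge0 ?ler_pdivrMl; lra.
Qed.

Lemma sa_square_disc T : sa_square T ->
  exists2 mu : R, 0 < mu & opbound (mu%:C *: (1 : adjop H) - T) mu.
Proof.
case=> k ksa ->; have [r r0 rk] := rescale_contraction k.
have [s [ssa ss _ s1 _]] := sa_contraction_sine (sa_scale r ksa) rk.
have ss1 : opbound (s * s) (1 * 1) by apply: opboundM.
exists (r ^- 2); first by rewrite invr_gt0 exprn_gt0.
move: (opboundZ (r ^- 2) ss1); rewrite ss scaleM2 scalerBr scalerA.
rewrite -rmorphM mulVf ?expf_eq0 ?gt_eqF //= scale1r mul1r mulr1.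
by rewrite ger0_norm ?invr_ge0 ?exprn_ge0 // ltW.
Qed.

Lemma disc_root T mu : adj T = T -> 0 < mu ->
    opbound ((mu ^+ 2)%:C *: (1 : adjop H) - T) (mu ^+ 2) ->
  exists k : adjop H, [/\ adj k = k, opbound (mu%:C *: (1 : adjop H) - k) mu,
    T = k * k
    & forall Z, Z * T = T * Z -> Z * k = k * Z].
Proof.
move=> Tsa mu0 Tmu.
pose X : adjop H := 1 - (mu ^- 2)%:C *: T.
have Xsa : adj X = X by rewrite adj_sub adj_one sa_scale.
have X1 : opbound X 1.
  move: (opboundZ (mu ^- 2) Tmu); rewrite scalerBr scalerA -rmorphM.
  rewrite mulVf ?expf_eq0 ?gt_eqF //= scale1r ger0_norm ?invr_ge0 ?exprn_ge0 ?ltW //.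
  by rewrite mulVf ?expf_eq0 ?gt_eqF.
have [y [ysa y1 yy yZ]] := sqrt_1B Xsa X1.
exists (mu%:C *: (1 - y)); split.
- by rewrite sa_scale // adj_sub adj_one ysa.
- rewrite scalerBr opprB addrCA subrr addr0.
  by have := opboundZ mu y1; rewrite ger0_norm ?ltW // mulr1.
- rewrite scaleM2 yy /X opprB addrCA subrr addr0 scalerA -rmorphM.
  by rewrite divff ?expf_eq0 ?gt_eqF //= scale1r.
- move=> Z ZT; rewrite -scaleAr -scaleAl; congr (_ *: _).
  rewrite mulrBr mulrBl mulr1 mul1r yZ // /X mulrBr mulrBl mulr1 mul1r.
  by rewrite -scaleAr -scaleAl ZT.
Qed.

(** Self-adjoint squares are the self-adjoint T with |mu - T| <= mu for some
    mu > 0; this description makes their sums squares again. The square root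
    found is itself such a square. *)
Lemma disc_square T mu : adj T = T -> 0 < mu ->
    opbound (mu%:C *: (1 : adjop H) - T) mu ->
  exists r : adjop H, [/\ adj r = r, T = (r * r) * (r * r)
    & forall Z, Z * T = T * Z -> Z * r = r * Z].
Proof.
move=> Tsa mu0; have s0 : 0 < Num.sqrt mu by rewrite sqrtr_gt0.
rewrite -{1 2}(sqr_sqrtr (ltW mu0)) => Tmu.
have [k [ksa kmu Tk kZ]] := disc_root Tsa s0 Tmu.
have s1 : 0 < Num.sqrt (Num.sqrt mu) by rewrite sqrtr_gt0.
move: kmu; rewrite -{1 2}(sqr_sqrtr (ltW s0)) => kmu.
have [r [rsa _ kr rZ]] := disc_root ksa s1 kmu.
exists r; split=> //; first by rewrite -kr.
by move=> Z ZT; apply: rZ; exact: kZ.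
Qed.

Lemma sa_squareD S T : sa_square S -> sa_square T -> sa_square (S + T).
Proof.
move=> Ssq Tsq.
have [a a0 Sa] := sa_square_disc Ssq; have [b b0 Tb] := sa_square_disc Tsq.
have ST : opbound ((a + b)%:C *: (1 : adjop H) - (S + T)) (a + b).
  rewrite rmorphD /= scalerDl opprD addrACA; exact: opboundD.
have STsa : adj (S + T) = S + T by rewrite adj_add !sa_square_sa.
have [r [rsa STr _]] := disc_square STsa (addr_gt0 a0 b0) ST.
by exists (r * r) => //; rewrite adj_mul rsa.
Qed.

Lemma sa_squareZ r T : 0 <= r -> sa_square T -> sa_square (r%:C *: T).
Proof.
move=> r0 [k ksa ->]; exists ((Num.sqrt r)%:C *: k); first exact: sa_scale.
by rewrite scaleM2 sqr_sqrtr.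
Qed.

(** (1 + mu) x and (1 + T) x differ by a vector of norm at most mu |x|. *)
Lemma sa_square_expand T x : sa_square T -> rnorm x <= rnorm ((1 + T) x).
Proof.
move=> /sa_square_disc[mu mu0 Tmu].
have := Tmu x; have -> : (mu%:C *: (1 : adjop H) - T) x = (1 + mu)%:C *: x - (1 + T) x.
  by rewrite rmorphD /= scalerDl scale1r opprD addrACA subrr add0r.
have := rnormD ((1 + mu)%:C *: x - (1 + T) x) ((1 + T) x).
rewrite subrK rnormZ ger0_norm; lra.
Qed.

(** When v is the sine of an angle, v' is the sine of its double, whose square
    is 4 v^2 (1 - v^2). Through c this polynomial, evaluated at - w^2, becomes
    - 4 w^2 (1 + w^2), and 1 + w^2 is expanding. *)
Lemma sine_doubling c v w : adj v = v -> adj w = w -> opbound v 1 ->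
    c * (v * v) = - (w * w * c) ->
  exists v' w', [/\ adj v' = v', adj w' = w', opbound v' 1,
    c * (v' * v') = - (w' * w' * c)
    & forall x, 4 * rnorm ((c * (v * v)) x) <= rnorm ((c * (v' * v')) x)].
Proof.
move=> vsa wsa v1 cvw.
have [s [ssa ss sZ _ vs1]] := sa_contraction_sine vsa v1.
have vs : v * s = s * v by apply: sZ; rewrite mulrA.
pose t := v * v * (1 - v * v).
have v'v' : (v * s + v * s) * (v * s + v * s) = t + t + (t + t).
  have e : v * s * (v * s) = t.
    by rewrite /t -ss -!mulrA; congr (v * _); rewrite !mulrA -vs.
  by rewrite -e; ncring.
have cv' : c * t = (1 + w * w) * (c * (v * v)).
  have -> : c * t = c * (v * v) - c * (v * v) * (v * v).
    by rewrite /t; ncring.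
  by rewrite {2}cvw mulNr opprK mulrDl mul1r !mulrA.
have [w' w'sa w'w'] : sa_square ((w + w) * (w + w) + (w * w + w * w) * (w * w + w * w)).
  by apply: sa_squareD; [exists (w + w) | exists (w * w + w * w)];
    rewrite // adj_add ?adj_mul wsa.
have four : c * (t + t + (t + t)) = c * t + c * t + (c * t + c * t).
  by ncring.
exists (v * s + v * s), w'; split=> //.
- by rewrite adj_add adj_mul vsa ssa vs.
- rewrite v'v' four cv' cvw -w'w'; ncring.
- move=> x; rewrite v'v'.
  have -> : c * (t + t + (t + t)) = 4%:C *: (c * t).
    by rewrite four (rmorph_nat (real_complex R)) scaler_nat -!mulr2n -mulrnA.
  rewrite -[X in _ <= rnorm X]/(4%:C *: ((c * t) x)).
  rewrite rnormZ ger0_norm ?ler0n // ler_wpM2l // cv'.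
  by apply: sa_square_expand; exists w.
Qed.

(** The norm of c v^2 at x is at most 4^-n times that of c v_n^2 at x, for the
    n-th doubling v_n, which is a contraction. *)
Lemma square_transfer_eq0 c v w : adj v = v -> adj w = w -> opbound v 1 ->
  c * (v * v) = - (w * w * c) -> c * (v * v) = 0.
Proof.
move=> vsa wsa v1 cvw; have [M M0 cM] := adjop_bounded c.
apply: (op_eq0 (@geometric_small R 4^-1 _) M0) => [|n].
  by rewrite invr_ge0 invf_lt1 ?ler0n ?ltr1n.
elim: n v w vsa wsa v1 cvw => [|n IH] v w vsa wsa v1 cvw.
  rewrite expr0 -(mulr1 1); apply: opboundM => //.
  by apply: opboundM.
have [v' [w' [v'sa w'sa v'1 cvw' le4]]] := sine_doubling vsa wsa v1 cvw.
move=> x; have := IH v' w' v'sa w'sa v'1 cvw' x; have := le4 x.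
rewrite exprS; set q := 4^-1 ^+ n; lra.
Qed.

(** Twice this sum is the sum of the squares of b + b* and i(b - b* ). *)
Lemma mul_adjD_square b : sa_square (b * adj b + adj b * b).
Proof.
pose I : adjop H := 'i *: (1 : adjop H).
pose p := b + adj b; pose q := I * (b - adj b).
have IC T : I * T = T * I by rewrite -scaleAl -scaleAr mul1r mulr1.
have II : I * I = - 1.
  by rewrite -scaleAl mul1r scalerA -expr2 sqr_i scaleN1r.
have psa : adj p = p by rewrite adj_add adj_adj addrC.
have qsa : adj q = q.
  rewrite adj_mul adj_sub adj_adj adj_scale conji adj_one scaleNr mulrN -IC.
  by rewrite -mulrN opprB.
have qq : q * q = - ((b - adj b) * (b - adj b)).
  by rewrite {1}/q IC -mulrA (mulrA I) II mulN1r mulrN.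
have -> : b * adj b + adj b * b = 2^-1%:C *: (p * p + q * q).
  rewrite -[LHS]half_scale -scalerDr; congr (_ *: _).
  by rewrite qq /p; ncring.
by apply: sa_squareZ; [rewrite invr_ge0|apply: sa_squareD; [exists p|exists q]].
Qed.

(** In spectral terms, c c* and c* c have the same spectrum away from 0, while
    one is nonnegative and the other nonpositive. The elementary form of this
    argument: c c* is a square w^2 (by [mul_adjD_square], as c* c = - v^2), c
    intertwines w^2 with - v^2, and then [square_transfer_eq0] applies. *)
Lemma adj_mul_neg_square c v : adj v = v -> adj c * c = - (v * v) -> v = 0.
Proof.
move=> vsa cv.
have [r r0 rv1] := rescale_contraction v.
have asa : adj (r%:C *: v) = r%:C *: v by exact: sa_scale.
have ba : adj (r%:C *: c) * (r%:C *: c) = - ((r%:C *: v) * (r%:C *: v)).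
  by rewrite adj_scale conjR !scaleM2 cv scalerN.
suff a0 : r%:C *: v = 0.
  rewrite -[v]scale1r -(rmorph1 (real_complex R)) -(mulVf (lt0r_neq0 r0)).
  by rewrite rmorphM -scalerA a0 scaler0.
move: (r%:C *: v) (r%:C *: c) rv1 asa ba => a b a1 asa ba {c v vsa cv r r0}.
have [w wsa ww] : sa_square (b * adj b).
  have -> : b * adj b = (b * adj b + adj b * b) + a * a.
    by rewrite ba addrNK.
  by apply: sa_squareD (mul_adjD_square b) _; exists a.
have bw : b * (a * a) = - (w * w * b).
  by rewrite -ww -mulrA ba mulrN opprK.
have baa0 := square_transfer_eq0 asa wsa a1 bw.
have aa0 : a * a = 0.
  apply: adj_mul_eq0; rewrite adj_mul asa.
  by rewrite -[a * a in X in X * _]opprK -ba mulNr -mulrA baa0 mulr0 oppr0.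
by apply: adj_mul_eq0; rewrite asa.
Qed.

(** Positive operators are squares of self-adjoint operators. With tau the
    root of T^2 and n = tau - T, the operator S n satisfies the hypothesis of
    [adj_mul_neg_square], which forces n = 0. *)
Lemma op_pos_square T : op_pos T -> sa_square T.
Proof.
case=> S TS.
have Tsa : adj T = T by rewrite TS adj_mul adj_adj.
have TTsa : adj (T * T) = T * T by rewrite adj_mul Tsa.
have [mu mu0 TTmu] : exists2 mu : R, 0 < mu & opbound (mu%:C *: (1 : adjop H) - T * T) mu.
  by apply: sa_square_disc; exists T.
have [r [rsa TTr rZ]] := disc_square TTsa mu0 TTmu.
have rT : T * r = r * T by apply: rZ; rewrite mulrA.
(* n is twice the negative part of T: tau n = - T n *)
pose tau := r * r; pose n := tau - T.
have tausa : adj tau = tau by rewrite adj_mul rsa.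
have nsa : adj n = n by rewrite adj_sub tausa Tsa.
have rn : r * n = n * r by rewrite mulrBr mulrBl -rT /tau mulrA.
have tauT : T * tau = tau * T by rewrite /tau mulrA rT -mulrA rT mulrA.
have Tn : T * n = - (tau * n).
  by rewrite /n !mulrBr -/tau tauT TTr opprB.
have rn0 : r * n = 0.
  apply: (@adj_mul_neg_square (S * n)); first by rewrite adj_mul nsa rsa rn.
  rewrite adj_mul nsa -mulrA (mulrA _ S) -TS Tn mulrN; congr (- _).
  by rewrite /tau !mulrA rn.
have taun0 : tau * n = 0 by rewrite /tau -mulrA rn0 mulr0.
have n0 : n = 0.
  by apply: adj_mul_eq0; rewrite nsa {1}/n mulrBl Tn taun0 oppr0 subrr.
by exists r => //; apply/esym/subr0_eq.
Qed.

Lemma square_op_pos T : sa_square T -> op_pos T.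
Proof. by case=> k ksa ->; exists k; rewrite ksa. Qed.

(** If k^2 + l^2 = 0, then [adj_mul_neg_square] applies with c = k. *)
Lemma op_posD_eq0 S T : op_pos S -> op_pos T -> S + T = 0 -> S = 0.
Proof.
move=> /op_pos_square[k ksa ->] /op_pos_square[l lsa ->] kl.
have l0 : l = 0.
  apply: (@adj_mul_neg_square k) => //.
  by rewrite ksa; apply: (addIr (l * l)); rewrite kl addNr.
by move: kl; rewrite l0 mulr0 addr0.
Qed.

Lemma op_pos_sa T : op_pos T -> adj T = T.
Proof. by move=> /op_pos_square/sa_square_sa. Qed.

Lemma op_pos_root T : op_pos T ->
  exists K, [/\ op_pos K, K * K = T & forall Z, Z * T = T * Z -> Z * K = K * Z].
Proof.
move=> Tpos; have [mu mu0 Tmu] := sa_square_disc (op_pos_square Tpos).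
have [r [rsa Tr rZ]] := disc_square (op_pos_sa Tpos) mu0 Tmu.
exists (r * r); split; [by exists r; rewrite rsa | by [] |].
by move=> Z /rZ Zr; rewrite mulrA Zr -mulrA Zr mulrA.
Qed.

Lemma op_pos_conj S T : op_pos T -> op_pos (adj S * T * S).
Proof.
move=> /op_pos_square[k ksa ->]; exists (k * S).
by rewrite adj_mul ksa !mulrA.
Qed.

(** Both are compared with the root L supplied by [op_pos_root], which commutes
    with everything that commutes with the square. For commuting roots S and
    K, with d = S - K, the positive operators d S d and d K d add up to 0,
    whence d^3 = 0. *)
Lemma op_pos_root_unique S K : op_pos S -> op_pos K -> S * S = K * K -> S = K.
Proof.
suff root_eq S' K' : op_pos S' -> op_pos K' -> S' * S' = K' * K' ->
    S' * K' = K' * S' -> S' = K'.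
  move=> Spos Kpos SK.
  have [L [Lpos LL LZ]] : exists L, [/\ op_pos L, L * L = K * K
      & forall Z, Z * (K * K) = K * K * Z -> Z * L = L * Z].
    apply: op_pos_root; exists K; by rewrite op_pos_sa.
  have -> : S = L.
    apply: root_eq => //; first by rewrite LL.
    by apply: LZ; rewrite -SK mulrA.
  apply/esym; apply: root_eq => //.
  by apply: LZ; rewrite mulrA.
move=> Spos Kpos SK SKC.
pose d := S' - K'.
have dsa : adj d = d by rewrite adj_sub !op_pos_sa.
have dd : d * S' * d + d * K' * d = 0.
  have -> : d * S' * d + d * K' * d =
      (S' * S' - K' * K' + (S' * K' - K' * S')) * d by rewrite /d; ncring.
  by rewrite SK SKC !subrr addr0 mul0r.
have dS : op_pos (d * S' * d) by rewrite -{1}dsa; exact: op_pos_conj.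
have dK : op_pos (d * K' * d) by rewrite -{1}dsa; exact: op_pos_conj.
have dSd0 := op_posD_eq0 dS dK dd.
have dKd0 : d * K' * d = 0 by move: dd; rewrite dSd0 add0r.
have ddd : d * d * d = 0.
  have -> : d * d * d = d * S' * d - d * K' * d by rewrite /d; ncring.
  by rewrite dSd0 dKd0 subrr.
apply: subr0_eq; apply: adj_mul_eq0; rewrite -/d dsa.
by apply: adj_mul_eq0; rewrite adj_mul dsa mulrA ddd mul0r.
Qed.

Lemma sqrtopP T : op_pos T -> op_pos (sqrtop T) /\ sqrtop T * sqrtop T = T.
Proof.
move=> /op_pos_root[K [Kpos KK _]].
by rewrite /sqrtop; case: xgetP => [S _ //|/(_ K) []].
Qed.

Lemma sqrtop_eq S T : op_pos S -> S * S = T -> sqrtop T = S.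
Proof.
move=> Spos SS; have Tpos : op_pos T by exists S; rewrite op_pos_sa.
have [? ?] := sqrtopP Tpos.
by apply: op_pos_root_unique => //; rewrite SS.
Qed.

Lemma op_pos_comm K Z : op_pos K -> Z * (K * K) = K * K * Z -> Z * K = K * Z.
Proof.
move=> Kpos ZKK; have KKpos : op_pos (K * K) by exists K; rewrite op_pos_sa.
have [L [Lpos LL LZ]] := op_pos_root KKpos.
by rewrite -(op_pos_root_unique Lpos Kpos LL); exact: LZ.
Qed.

Lemma op_pos_mul S T : op_pos S -> op_pos T -> S * T = T * S -> op_pos (S * T).
Proof.
move=> Spos Tpos ST; have [K [Kpos KK KZ]] := op_pos_root Spos.
have KT : T * K = K * T by apply: KZ.
by rewrite -KK -mulrA -KT mulrA -{1}(op_pos_sa Kpos); exact: op_pos_conj.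
Qed.

(** ** Inverses *)

(** A Neumann series: 1 + T is 1 + mu minus an operator bounded by mu. *)
Lemma inverse_1D T : sa_square T ->
  exists X, X * (1 + T) = 1 /\ (1 + T) * X = 1.
Proof.
move=> Tsq; have [mu mu0 Tmu] := sa_square_disc Tsq.
pose q := mu / (1 + mu); have m1 : 0 < 1 + mu by lra.
pose Z : adjop H := (1 + mu)^-1%:C *: (mu%:C *: (1 : adjop H) - T).
have Zsa : adj Z = Z.
  by rewrite sa_scale // adj_sub (sa_square_sa Tsq) sa_scale // adj_one.
have Zq : opbound Z q.
  by have := opboundZ (1 + mu)^-1 Tmu; rewrite ger0_norm ?invr_ge0 ?ltW // mulrC.
have TZ : 1 + T = (1 + mu)%:C *: (1 - Z).
  rewrite scalerBr scalerA -rmorphM divff ?gt_eqF //= scale1r.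
  by rewrite rmorphD /= scalerDl scale1r opprB addrA addrAC addrK.
have q01 : 0 <= q < 1.
  by rewrite divr_ge0 ?ltW //= ltr_pdivrMr // mul1r; lra.
(* partial sums of the geometric series of Z *)
pose fix Y n : adjop H := if n is m.+1 then 1 + Z * Y m else 0.
have ZY n : Z * Y n = Y n * Z.
  elim: n => [|n IH] /=; first by rewrite mulr0 mul0r.
  by rewrite mulrDr mulrDl mulr1 mul1r {1}IH mulrA.
have Ysa n : adj (Y n) = Y n.
  elim: n => [|n IH] /=; first exact: adj_zero.
  by rewrite adj_add adj_one adj_mul IH Zsa ZY.
have dY n : opbound (Y n.+1 - Y n) (q ^+ n).
  elim: n => [|n IH]; first by rewrite /= mulr0 addr0 subr0 expr0; exact: opbound1.
  have -> : Y n.+2 - Y n.+1 = Z * (Y n.+1 - Y n).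
    by rewrite /=; ncring.
  by rewrite exprS; apply: opboundM => //; case/andP: q01.
have dYd n d : opbound (Y (n + d)%N - Y n) ((q ^+ n - q ^+ (n + d)) / (1 - q)).
  elim: d => [|d IH]; first by rewrite addn0 !subrr mul0r; exact: opbound0.
  rewrite addnS; have := opboundD (dY (n + d)%N) IH.
  rewrite subrKA; apply: opbound_le; rewrite exprS.
  set a := q ^+ (n + d); set b := q ^+ n.
  rewrite le_eqVlt; apply/orP; left; apply/eqP; field.
  by lra.
have q1 : 0 < 1 - q by lra.
have e0 eps : 0 < eps -> exists n, q ^+ n / (1 - q) < eps.
  move=> eps0; have [n] := geometric_small q01 (mulr_gt0 eps0 q1).
  by exists n; rewrite ltr_pdivrMr.
have qn n : 0 <= q ^+ n by case/andP: q01 => ? ?; rewrite exprn_ge0.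
have Ye n m : (n <= m)%N -> opbound (Y m - Y n) (q ^+ n / (1 - q)).
  move=> nm; have := dYd n (m - n)%N; rewrite subnKC //; apply: opbound_le.
  by rewrite ler_pM2r ?invr_gt0 // gerBl.
have [L [Lsa LY LZ]] := selfadj_limit e0
  (fun n => divr_ge0 (qn n) (ltW q1)) Ysa Ye.
have ZL : Z * L = L * Z by exact: LZ.
have L1 : (1 - Z) * L = 1.
  apply/subr0_eq; apply: (op_eq0 e0 (ler0n _ 2)) => n.
  have -> : (1 - Z) * L - 1 = (L - Y n.+1) - Z * (L - Y n) by rewrite /=; ncring.
  have q0 : 0 <= q by case/andP: q01.
  have := opboundB (LY n.+1) (opboundM q0 Zq (LY n)).
  apply: opbound_le; rewrite exprS.
  have : 0 <= q ^+ n / (1 - q) by rewrite divr_ge0 // ltW.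
  set a := q ^+ n => a0.
  have -> : q * a / (1 - q) = q * (a / (1 - q)) by rewrite mulrA.
  by case/andP: q01 => ? ?; nra.
exists ((1 + mu)^-1%:C *: L); split.
  rewrite TZ -scaleAl -scaleAr scalerA -rmorphM mulVf ?gt_eqF //= scale1r.
  by rewrite mulrBr -ZL mulr1 -L1; ncring.
by rewrite TZ -scaleAl -scaleAr scalerA -rmorphM divff ?gt_eqF //= scale1r.
Qed.

End Positive.

(** * Polar decompositions *)

Section Polar.
Context {R : realType} {A : cstarAlgType R} {H : hilbertModType A}.
Implicit Types (x y z : H) (S T U X Y Z D K V W p : adjop H) (M : set H).

Lemma closure_rnorm M x : closure M x <->
  forall eps : R, 0 < eps -> exists2 y, M y & rnorm (x - y) < eps.
Proof.
split=> [Mx eps eps0|Mx B].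
  have eps0' : 0 < eps%:C by rewrite ltcR.
  have [y [My]] := Mx _ (nbhsx_ballx x _ eps0').
  by rewrite -ball_normE /= rnormE ltcR; exists y.
move=> /nbhs_ballP[e /= e0 eB].
have [e1 e2] : e = (complex.Re e)%:C /\ 0 < complex.Re e.
  move: e0; case: (e) => a b; rewrite ltcE /= => /andP[/eqP -> ?].
  by split.
have [y My xy] := Mx _ e2; exists y; split=> //; apply: eB.
by rewrite -ball_normE /= rnormE e1 ltcR.
Qed.

Lemma closure_op_eq V W M x : (forall y, M y -> V y = W y) ->
  closure M x -> V x = W x.
Proof.
move=> VW /closure_rnorm Mx; have [k k0 kT] := adjop_bounded (V - W).
apply/eqP; rewrite -subr_eq0; apply/eqP/rnorm_eq0/eqP.
rewrite eq_le rnorm_ge0 andbT leNgt; apply/negP => d0.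
have k1 : 0 < k + 1 by lra.
have [y My] := Mx _ (divr_gt0 d0 k1).
rewrite ltr_pdivlMr // => lt1.
have := kT (x - y); rewrite opB.
rewrite -[(V - W) y]/(V y - W y) VW // subrr subr0.
rewrite -[(V - W) x]/(V x - W x).
have := rnorm_ge0 (x - y); lra.
Qed.

Lemma closure_op_image V M x : closure M x -> closure (V @` M) (V x).
Proof.
move=> /closure_rnorm Mx; apply/closure_rnorm => eps eps0.
have [k k0 kV] := adjop_bounded V; have k1 : 0 < k + 1 by lra.
have [y My] := Mx _ (divr_gt0 eps0 k1); rewrite ltr_pdivlMr // => lt1.
exists (V y); first by exists y.
rewrite -opB; apply: le_lt_trans (kV _) _.
by have := rnorm_ge0 (x - y); lra.
Qed.

(** ** Projections and complemented sets *)

Lemma range_idem p x : is_idempotent p -> range p x -> p x = x.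
Proof. by move=> pp [y _ <-]; rewrite -[p (p y)]/((p * p) y) pp. Qed.

Lemma projection_inj p q : is_projection p -> is_projection q ->
  range p = range q -> p = q.
Proof.
move=> [pp psa] [qq qsa] pq.
have pqq : p * q = q.
  apply: adjop_ext => x; apply: (range_idem pp); rewrite pq.
  by exists x.
have qpp : q * p = p.
  apply: adjop_ext => x; apply: (range_idem qq); rewrite -pq.
  by exists x.
by rewrite -psa -qpp adj_mul psa qsa.
Qed.

Lemma proj_on_range p : is_projection p -> proj_on (range p) = p.
Proof.
move=> pproj; rewrite /proj_on; case: xgetP => [q _ [qproj qp]|/(_ p) []//].
exact: projection_inj.
Qed.

Lemma complemented_projection M : orth_complemented M ->
  exists2 p, is_projection p & range p = M.
Proof.
move=> MC.
have dec x : exists uv : H * H, [/\ M uv.1, Defs.ortho M uv.2 & uv.1 + uv.2 = x].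
  have [u Mu [v Mv uv]] : [set x + y | x in M & y in Defs.ortho M] x by rewrite MC.
  by exists (u, v).
pose f x := (sval (cid (dec x))).1; pose g x := (sval (cid (dec x))).2.
have fP x : [/\ M (f x), Defs.ortho M (g x) & f x + g x = x].
  by rewrite /f /g; case: cid.
have fg x y : inner (f x) (g y) = 0.
  by have [Mx _ _] := fP x; have [_ gy _] := fP y; exact: gy.
have gf x y : inner (g x) (f y) = 0 by rewrite -inner_star fg astar0.
have fsa x y : inner (f x) y = inner x (f y).
  have [_ _ ex] := fP x; have [_ _ ey] := fP y.
  by rewrite -{1}ey -{2}ex innerDr innerDl fg gf.
have fM x : M x -> f x = x.
  move=> Mx; have [Mf gM ex] := fP x.
  suff g0 : g x = 0 by rewrite -{2}ex g0 addr0.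
  apply: inner_eq0; have : inner x (g x) = 0 by exact: gM.
  by rewrite -{1}ex innerDl fg add0r.
exists (AdjOp fsa); first split.
- by apply: adjop_ext => x /=; apply: fM; have [] := fP x.
- exact: adjop_ext.
- apply/seteqP; split=> [_ [x _ <-]|x Mx]; first by have [] := fP x.
  by exists x => //=; exact: fM.
Qed.

Lemma projection_complemented p : is_projection p ->
  orth_complemented (range p).
Proof.
move=> [pp psa]; apply/seteqP; split=> // x _.
exists (p x); first by exists x.
exists ((1 - p) x); last by rewrite /= addrC subrK.
move=> _ [y _ <-]; rewrite opP -[opadj p _]/((adj p * (1 - p)) x) psa.
by rewrite mulrBr mulr1 pp subrr inner0r.
Qed.

Lemma projection_ker p T : is_projection p -> adj T * T = p -> T * p = T.
Proof.
move=> [pp psa] TT; apply/esym/subr0_eq/adj_mul_eq0.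
have -> : T - T * p = T * (1 - p) by rewrite mulrBr mulr1.
rewrite adj_mul adj_sub adj_one psa -mulrA (mulrA (adj T)) TT.
by rewrite (mulrBr p) mulr1 pp subrr mulr0.
Qed.

(** ** A criterion *)

Definition polar_pair T U K :=
  [/\ is_projection (adj U * U), op_pos K, T = U * K
    & closure (range K) = range (adj U * U)].

Lemma absopP T : op_pos (absop T) /\ absop T * absop T = adj T * T.
Proof. by apply: sqrtopP; exists T. Qed.

Lemma polar_pair_supp T U K : polar_pair T U K ->
  adj U * U * K = K /\ K * (adj U * U) = K.
Proof.
move=> [pproj Kpos _ Krange]; have [pp psa] := pproj.
have pK : adj U * U * K = K.
  apply: adjop_ext => x; apply: (range_idem pp); rewrite -Krange.
  by apply: subset_closure; exists x.
by split=> //; rewrite -{1}(op_pos_sa Kpos) -{1}psa -adj_mul pK op_pos_sa.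
Qed.

Lemma polar_pair_sq T U K : polar_pair T U K -> adj T * T = K * K.
Proof.
move=> TUK; have [pK _] := polar_pair_supp TUK; case: TUK => _ Kpos -> _.
by rewrite adj_mul (op_pos_sa Kpos) -mulrA (mulrA (adj U)) pK.
Qed.

(** In such a pair K is the absolute value of T and has the range of T*, which
    makes the existence of a pair insensitive to how K was found. *)
Lemma polarP T : has_polar_decomposition T <-> exists U K, polar_pair T U K.
Proof.
have same_range U K : adj T = K * adj U -> K = adj T * U ->
    range (adj T) = range K.
  move=> TK KT; apply/seteqP; split=> [_ [x _ <-]|_ [x _ <-]].
    by rewrite TK; exists (adj U x).
  by rewrite KT; exists (U x).
split=> [[/complemented_projection[p pproj pM] [U [Uproj TU UU]]]|].
  rewrite -pM proj_on_range // in UU.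
  have [Kpos KK] := absopP T; have [pp psa] := pproj.
  exists U, (absop T); split=> //; rewrite UU pM; congr closure.
  have Kp : absop T * p = absop T.
    apply/esym/subr0_eq/adj_mul_eq0.
    have -> : absop T - absop T * p = absop T * (1 - p).
      by rewrite mulrBr mulr1.
    have pT : p * adj T = adj T.
      apply: adjop_ext => x; apply: (range_idem pp); rewrite pM.
      by apply: subset_closure; exists x.
    rewrite adj_mul (op_pos_sa Kpos) -mulrA (mulrA (absop T)) KK !mulrA.
    by rewrite adj_sub adj_one psa mulrBl mul1r pT subrr !mul0r.
  apply/esym/(@same_range U); first by rewrite {1}TU adj_mul op_pos_sa.
  by rewrite {2}TU adj_mul (op_pos_sa Kpos) -mulrA UU Kp.
move=> [U [K TUK]]; have [pK Kp] := polar_pair_supp TUK.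
have TT := polar_pair_sq TUK; case: TUK => pproj Kpos TUK Krange.
have TK : absop T = K by apply: sqrtop_eq.
have Trange : range (adj T) = range K.
  apply: (@same_range U); first by rewrite TUK adj_mul op_pos_sa.
  by rewrite TUK adj_mul (op_pos_sa Kpos) -mulrA Kp.
rewrite /has_polar_decomposition Trange Krange; split.
  exact: projection_complemented.
by exists U; split=> //; rewrite ?TK // proj_on_range.
Qed.

(** ** Transformations preserving polar decompositions *)

(** V is isometric on the range of p, hence maps closures to closures. *)
Lemma closure_range_conj V p K : is_projection p -> adj K = K ->
    closure (range K) = range p -> adj V * V * p = p ->
  closure (range (V * K * adj V)) = range (V * p * adj V).
Proof.
move=> [pp psa] Ksa Kp Vp.
have pK : p * K = K.
  apply: adjop_ext => x; apply: (range_idem pp); rewrite -Kp.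
  by apply: subset_closure; exists x.
have VK : adj V * V * K = K by rewrite -pK mulrA Vp.
have KV : K * (adj V * V) = K.
  by move: (congr1 (@adj _ _ _) VK); rewrite !adj_mul adj_adj Ksa.
apply/seteqP; split=> x.
  move=> Vx; exists x => //.
  apply: (@closure_op_eq _ 1 _ _ _ Vx) => _ [y _ <-].
  rewrite -[LHS]/((V * p * adj V * (V * K * adj V)) y); congr (op _ y).
  by rewrite !mulrA -(mulrA _ (adj V)) -(mulrA _ _ K) VK -(mulrA V p) pK.
move=> [y _ <-].
have : closure (range K) (p (adj V y)) by rewrite Kp; exists (adj V y).
move=> /(@closure_op_image V); apply: closure_subset => _ [_ [z _ <-] <-].
exists (V z) => //; rewrite -[LHS]/((V * K * adj V * V) z).
by rewrite -!mulrA KV.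
Qed.

(** From T = U |T| follows T* = U* |T*| with |T*| = U |T| U*. *)
Lemma polar_adj T :
  has_polar_decomposition T -> has_polar_decomposition (adj T).
Proof.
move=> /polarP[U [K TUK]]; have [pK _] := polar_pair_supp TUK.
case: TUK => pproj Kpos TUK Krange.
have Up := projection_ker pproj erefl.
apply/polarP; exists (adj U), (U * K * adj U); rewrite /polar_pair adj_adj.
split.
- split; last by rewrite adj_mul adj_adj.
  by rewrite /is_idempotent mulrA -(mulrA U) Up.
- by have := op_pos_conj (adj U) Kpos; rewrite adj_adj.
- by rewrite TUK adj_mul (op_pos_sa Kpos) !mulrA pK.
- rewrite (closure_range_conj pproj (op_pos_sa Kpos) Krange) ?Up //.
  by case: pproj.
Qed.

(** The absolute value of V T Z is Z* |T| Z. *)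
Lemma polar_unitary V T Z : adj V * V = 1 -> adj Z * Z = 1 -> Z * adj Z = 1 ->
  has_polar_decomposition T -> has_polar_decomposition (V * T * Z).
Proof.
move=> VV ZZ ZZ' /polarP[U [K [pproj Kpos TUK Krange]]].
have UU : adj (V * U * Z) * (V * U * Z) = adj Z * (adj U * U) * Z.
  by rewrite !adj_mul !mulrA -(mulrA _ (adj V)) VV mulr1.
apply/polarP; exists (V * U * Z), (adj Z * K * Z); split.
- rewrite UU; case: pproj => pp psa; split; last first.
    by rewrite !adj_mul !adj_adj !mulrA.
  rewrite /is_idempotent -!mulrA (mulrA Z) ZZ' mul1r.
  by rewrite !mulrA -(mulrA _ (adj U) U) -(mulrA (adj Z)) -(mulrA (adj Z)) pp.
- exact: op_pos_conj.
- by rewrite TUK -!mulrA (mulrA Z) ZZ' mul1r.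
- rewrite UU.
  have := @closure_range_conj (adj Z) _ _ pproj (op_pos_sa Kpos) Krange.
  by rewrite adj_adj ZZ' mul1r; apply.
Qed.

(** D commutes with |T|, so |T| D is positive, with the range of |T| because D
    is onto; the partial isometry is unchanged. *)
Lemma polar_mulr T D X : op_pos D -> D * X = 1 ->
    D * (adj T * T) = adj T * T * D ->
  has_polar_decomposition T -> has_polar_decomposition (T * D).
Proof.
move=> Dpos DX DT /polarP[U [K TUK]].
rewrite (polar_pair_sq TUK) in DT; case: TUK => pproj Kpos TUK Krange.
have DK := op_pos_comm Kpos DT.
apply/polarP; exists U, (K * D); split=> //.
- exact: op_pos_mul.
- by rewrite TUK mulrA.
- rewrite -Krange; congr closure; apply/seteqP; split=> _ [x _ <-].
    by exists (D x).
  exists (X x) => //; rewrite -[LHS]/((K * (D * X)) x).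
  by rewrite DX mulr1.
Qed.

End Polar.

(** * Inverses and commutation *)

Section RingInverse.
Context {B : pzRingType}.
Implicit Types (x y z i : B).

Lemma inverse_of_square x y : y * (x * x) = 1 -> x * x * y = 1 ->
  exists i, i * x = 1 /\ x * i = 1.
Proof.
move=> yxx xxy; exists (y * x); rewrite -mulrA; split=> //.
have -> : y * x = x * y.
  by rewrite -[LHS]mulr1 -xxy -!mulrA (mulrA x x) (mulrA y) yxx mul1r.
by rewrite mulrA.
Qed.

Lemma inverse_comm x i z : i * x = 1 -> x * i = 1 -> z * x = x * z ->
  z * i = i * z.
Proof.
move=> ix xi zx.
by rewrite -[LHS]mul1r -ix -!mulrA (mulrA x) -zx -mulrA xi mulr1.
Qed.
End RingInverse.

Section OperatorInverse.
Context {R : realType} {A : cstarAlgType R} {H : hilbertModType A}.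
Implicit Types (S T U X Y Z D K V W p : adjop H).

Lemma inverse_sa T X : X * T = 1 -> T * X = 1 -> adj T = T -> adj X = X.
Proof.
move=> XT TX Tsa; have aXT : adj X * T = 1 by rewrite -{1}Tsa -adj_mul TX adj_one.
by rewrite -[LHS]mulr1 -TX mulrA aXT mul1r.
Qed.

Lemma op_pos_inverse T X : X * T = 1 -> T * X = 1 -> op_pos T -> op_pos X.
Proof.
move=> XT TX Tpos; have Xsa := inverse_sa XT TX (op_pos_sa Tpos).
by have := op_pos_conj X Tpos; rewrite Xsa XT mul1r.
Qed.

Lemma invop_eq T X : X * T = 1 -> T * X = 1 -> invop T = X.
Proof.
move=> XT TX; rewrite /invop; case: xgetP => [Y _ [YT TY]|/(_ X) []//].
by rewrite -[LHS]mulr1 -TX mulrA YT mul1r.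
Qed.

Lemma mpinv_eq T X : T * X * T = T -> X * T * X = X ->
  adj (T * X) = T * X -> adj (X * T) = X * T -> mpinv T = X.
Proof.
move=> TXT XTX TXsa XTsa; rewrite /mpinv.
case: xgetP => [Y _ [TYT YTY TYsa YTsa]|/(_ X) []//].
have TYX : T * Y = T * X.
  by rewrite -TYsa -{1}TXT -[T * X * T * Y]mulrA adj_mul TYsa TXsa mulrA TYT.
have YXT : Y * T = X * T.
  by rewrite -YTsa -{1}TXT -[T * X * T]mulrA mulrA adj_mul YTsa XTsa -mulrA (mulrA T) TYT.
by rewrite -YTY YXT -mulrA TYX mulrA XTX.
Qed.
End OperatorInverse.

(** * The matched pair of an idempotent *)

Section RangeProjection.
Context {R : realType} {A : cstarAlgType R} {H : hilbertModType A}.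
Implicit Types (Q S T U X Y Z D K V W p : adjop H).

(** The self-adjoint operator t = Q + Q* - 1 is invertible because its square
    is 1 + (Q - Q* )* (Q - Q* ), and Q t^-1 is the projection onto the range
    of Q. *)
Lemma idempotent_range_projection Q (t := Q + adj Q - 1) : is_idempotent Q ->
  exists2 p, is_projection p /\ range p = range Q &
    p * t = Q /\ exists Y, Y * (t * t) = 1 /\ t * t * Y = 1.
Proof.
move=> QQ; have QQ' : adj Q * adj Q = adj Q by rewrite -adj_mul QQ.
have tsa : adj t = t by rewrite adj_sub adj_add adj_adj adj_one (addrC (adj Q)).
have tt : t * t = 1 + adj (Q - adj Q) * (Q - adj Q).
  rewrite adj_sub adj_adj /t.
  have -> : (Q + adj Q - 1) * (Q + adj Q - 1) =
     1 + (adj Q - Q) * (Q - adj Q) + (Q * Q - Q) + (Q * Q - Q)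
     + (adj Q * adj Q - adj Q) + (adj Q * adj Q - adj Q) by ncring.
  by rewrite QQ QQ' !subrr !addr0.
have [Y [Ytt ttY]] : exists Y, Y * (t * t) = 1 /\ t * t * Y = 1.
  rewrite tt; apply: inverse_1D; apply: op_pos_square.
  by exists (Q - adj Q).
have [i [it ti]] := inverse_of_square Ytt ttY.
have isa := inverse_sa it ti tsa.
have tQ : t * Q = adj Q * Q by rewrite mulrBl mulrDl QQ mul1r addrAC subrr add0r.
have Qt : adj Q * t = t * Q by rewrite tQ mulrBr mulrDr QQ' mulr1 addrK.
have p2 : Q * i = i * adj Q.
  by rewrite -[LHS]mul1r -it -mulrA (mulrA t) -Qt -(mulrA (adj Q)) ti mulr1.
exists (Q * i); last by split; [rewrite -mulrA it mulr1 | exists Y].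
split; first split.
- by rewrite /is_idempotent {1}p2 -mulrA (mulrA (adj Q)) -tQ -(mulrA t) mulrA it mul1r.
- by rewrite adj_mul isa p2.
- apply/seteqP; split=> _ [x _ <-]; first by exists (i x).
  exists (t x) => //; rewrite -[LHS]/((Q * i * t) x).
  by rewrite -mulrA it mulr1.
Qed.

End RangeProjection.

Section MatchedPair.
Context {R : realType} {A : cstarAlgType R} {H : hilbertModType A}.
Implicit Types (Q S T U X Y Z D K V W : adjop H).

Local Notation half := (2^-1%:C : R[i]).

(** For the idempotent Q = p t these are t = Q + Q* - 1, the range projection
    p, b = |t|, i = 1 / b and c = 1 / (1 + b). The relation between p and t
    expresses Q + Q* = 1 + t. It makes p commute with t^2, so that b, i and c
    commute with both t and p. *)
Context (t p b i c : adjop H).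
Hypotheses (tsa : adj t = t) (pproj : is_projection p).
Hypothesis pt : p * t + t * p = 1 + t.
Hypotheses (bpos : op_pos b) (bb : b * b = t * t).
Hypotheses (ib : i * b = 1) (bi : b * i = 1).
Hypotheses (c1b : c * (1 + b) = 1) (bc1 : (1 + b) * c = 1).

Let pp : p * p = p. Proof. by case: pproj. Qed.
Let psa : adj p = p. Proof. by case: pproj. Qed.
Let bsa : adj b = b. Proof. exact: op_pos_sa. Qed.
Let ptE : p * t = 1 + t - t * p. Proof. by rewrite -pt addrK. Qed.

Let ptp : p * t * p = p.
Proof. by rewrite ptE mulrBl mulrDl mul1r -mulrA pp addrK. Qed.

Let pb : p * b = b * p.
Proof.
apply: op_pos_comm => //; rewrite bb mulrA ptE.
have -> : (1 + t - t * p) * t = t + t * t - t * (p * t) by ncring.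
by rewrite ptE; ncring.
Qed.

Let pbb : p * (b * b) = b * b * p.
Proof. by rewrite mulrA pb -mulrA pb mulrA. Qed.

Let tb : t * b = b * t.
Proof. by apply: op_pos_comm; rewrite // bb mulrA. Qed.

Let comm_i Z : Z * b = b * Z -> Z * i = i * Z.
Proof. exact: inverse_comm. Qed.

Let comm_c Z : Z * b = b * Z -> Z * c = c * Z.
Proof.
move=> Zb; apply: inverse_comm c1b bc1 _.
by rewrite mulrDr mulrDl mulr1 mul1r Zb.
Qed.

Let ic : i * c = c * i.
Proof. by apply: comm_c; rewrite ib bi. Qed.

Let itit : (i * t) * (i * t) = 1.
Proof.
have ti := comm_i tb.
by rewrite -mulrA (mulrA t) ti -!mulrA -bb (mulrA i b) ib mul1r.
Qed.

Let isa : adj i = i. Proof. exact: inverse_sa ib bi bsa. Qed.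

Let itsa : adj (i * t) = i * t.
Proof. by rewrite adj_mul tsa isa; exact: comm_i. Qed.

Let bt_factor : (b + t) * (1 + t) = (1 + b) * (b + t).
Proof.
have -> : (b + t) * (1 + t) = b + t + b * t + t * t by ncring.
by rewrite -bb; ncring.
Qed.

(** Q Q* = p t^2 p = (b p)^2. *)
Lemma absop_adj_idem Q : p * t = Q -> absop (adj Q) = b * p.
Proof.
move=> ptQ; apply: sqrtop_eq.
  have := op_pos_conj p bpos; rewrite psa pb.
  by rewrite -mulrA pp.
rewrite adj_adj -ptQ adj_mul tsa psa.
have -> : p * t * (t * p) = p * (b * b) * p by rewrite bb !mulrA.
by rewrite pbb -!mulrA pp (mulrA p) pb -mulrA pp.
Qed.

(** The defining formula of m(Q) collapses because (b + t) p (b + t) equals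
    (1 + b)(b + t): the reflection 2 m(Q) - 1 is the sign t / |t| of t. *)
Lemma matched_projectionE Q : p * t = Q ->
  matched_projection Q = half *: (1 + i * t).
Proof.
move=> ptQ; have tpQ : t * p = adj Q by rewrite -ptQ adj_mul tsa psa.
have ip : p * i = i * p := comm_i pb.
have cp : p * c = c * p := comm_c pb.
have mp : mpinv (b * p) = i * p.
  have e1 : b * p * (i * p) = p by rewrite -pb -mulrA (mulrA b) bi mul1r pp.
  have e2 : i * p * (b * p) = p by rewrite -ip -mulrA (mulrA i) ib mul1r pp.
  apply: mpinv_eq; rewrite ?e1 ?e2 //; first by rewrite -pb mulrA pp.
  by rewrite -ip mulrA pp.
have iv : invop (b * p + 1) = c * p + (1 - p).
  apply: invop_eq.
    have -> : (c * p + (1 - p)) * (b * p + 1) =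
      c * (p * b) * p + c * p + (b * p - (p * b) * p) + (1 - p) by ncring.
    rewrite pb -(mulrA b) pp subrr addr0 -(mulrA c) -(mulrA b) pp mulrA.
    by rewrite -mulrDl -{2}(mulr1 c) -mulrDr (addrC b) c1b mul1r addrC subrK.
  have -> : (b * p + 1) * (c * p + (1 - p)) =
      b * (p * c) * p + c * p + b * (p - p * p) + (1 - p) by ncring.
  rewrite cp pp subrr mulr0 addr0 -(mulrA b) -(mulrA c) pp mulrA.
  by rewrite -mulrDl -{2}(mul1r c) -mulrDl (addrC b) bc1 mul1r addrC subrK.
rewrite /matched_projection (absop_adj_idem ptQ) mp iv.
rewrite -(rmorph_nat (real_complex R)) -fmorphV -tpQ -ptQ.
congr (_ *: _).
have -> : 1 + i * t = i * (b + t) by rewrite mulrDr ib.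
have -> : (b * p + t * p) * (i * p) * (c * p + (1 - p)) * (b * p + p * t) =
   (b + t) * p * i * (p * c) * p * (b * p + p * t)
   + (b + t) * p * i * (p - p * p) * (b * p + p * t) by ncring.
rewrite pp subrr mulr0 mul0r addr0 cp -pb -mulrDr.
have -> : (b + t) * p * i * (c * p) * p * (p * (b + t)) =
    (b + t) * (p * i) * c * (p * p * p) * (b + t) by ncring.
have bti : (b + t) * i = i * (b + t).
  by rewrite mulrDl mulrDr bi ib (comm_i tb).
have btc : (b + t) * c = c * (b + t).
  by apply: comm_c; rewrite mulrDl mulrDr tb.
rewrite !pp ip.
have -> : (b + t) * (i * p) * c * p * (b + t) =
    ((b + t) * i) * (p * c) * p * (b + t) by ncring.
rewrite cp bti.
have -> : i * (b + t) * (c * p) * p * (b + t) =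
    i * ((b + t) * c) * (p * p * (b + t)) by ncring.
rewrite btc pp.
have -> : p * (b + t) = b * p + (1 + t - t * p) by rewrite mulrDr pb ptE.
have -> : i * (c * (b + t)) * (b * p + (1 + t - t * p)) =
    i * (c * ((b + t) * (1 + t) + (b * b - t * t) * p + (t * b - b * t) * p)).
  by ncring.
rewrite -bb tb !subrr !mul0r !addr0 bt_factor (mulrA c) c1b mul1r.
by [].
Qed.

Let m := half *: (1 + i * t).

Let m_sym : m * (i * t) = m /\ (i * t) * m = m.
Proof.
split; first by rewrite /m -scaleAl mulrDl mul1r itit addrC.
by rewrite /m -scaleAr mulrDr mulr1 itit addrC.
Qed.

Let mC : 1 - m = half *: (1 - i * t).
Proof.
apply: (addIr m); rewrite subrK /m -scalerDr addrACA addNr addr0.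
by rewrite scalerDr half_scale.
Qed.

Let mC_sym : (1 - m) * (i * t) = - (1 - m) /\ (i * t) * (1 - m) = - (1 - m).
Proof.
have [m1 m2] := m_sym.
have mm : i * t = m + m - 1 by rewrite half_scale addrC addKr.
by split; [rewrite mulrBl mul1r m1 | rewrite mulrBr mulr1 m2];
  rewrite mm opprB addrAC addrK.
Qed.

Let m_proj : is_projection m.
Proof.
have [m1 _] := m_sym; split; last first.
  by rewrite /m adj_scale conjR adj_add adj_one itsa.
by rewrite /is_idempotent {2}/m -scaleAr mulrDr mulr1 m1 scalerDr half_scale.
Qed.

Lemma matched_quasi_projection_pair Q : is_idempotent Q -> p * t = Q ->
  quasi_projection_pair (matched_projection Q) Q.
Proof.
move=> QQ ptQ; rewrite (matched_projectionE ptQ) -/m.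
have tpQ : t * p = adj Q by rewrite -ptQ adj_mul tsa psa.
have [m1 m2] := m_sym; have [n1 n2] := mC_sym.
have QE : adj Q = (i * t) * Q * (i * t).
  have ti := comm_i tb; have ip : p * i = i * p := comm_i pb.
  have -> : i * t * Q * (i * t) = t * p * ((i * t) * (i * t)).
    rewrite -ptQ -{1}ti.
    have -> : t * i * (p * t) * (i * t) = t * (i * p) * (t * (i * t)) by ncring.
    by rewrite -ip !mulrA.
  by rewrite itit mulr1.
split=> //; rewrite QE.
- have -> : m * (i * t * Q * (i * t)) * m = (m * (i * t)) * Q * (i * t * m).
    by rewrite !mulrA.
  by rewrite m1 m2.
- have -> : m * (i * t * Q * (i * t)) * (1 - m) =
      (m * (i * t)) * Q * (i * t * (1 - m)) by rewrite !mulrA.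
  by rewrite m1 n2 mulrN.
- have -> : (1 - m) * (i * t * Q * (i * t)) * (1 - m) =
      ((1 - m) * (i * t)) * Q * (i * t * (1 - m)) by rewrite !mulrA.
  by rewrite n1 n2 !mulNr mulrN opprK.
Qed.

(** With the symmetry e = 2 p - 1, the normal operator b + t e intertwines, up
    to functions of b, the operator p - Q with both corner operators. *)
Let e := p + p - 1.
Let G := b + t * e.

Let ee : e * e = 1.
Proof.
have -> : e * e = 1 + (p * p - p) *+ 2 *+ 2 by rewrite /e !mulr2n; ncring.
by rewrite pp subrr !mul0rn addr0.
Qed.

Let esa : adj e = e.
Proof. by rewrite /e adj_sub adj_add adj_one psa. Qed.

Let et : e * t + t * e = 1 + 1.
Proof.
have -> : e * t + t * e = (p * t + t * p) + (p * t + t * p) - (t + t).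
  by rewrite /e; ncring.
by rewrite pt; ncring.
Qed.

Let eb : e * b = b * e.
Proof. by rewrite /e mulrBl mulrBr mulrDl mulrDr pb mul1r mulr1. Qed.

Let Gsa : adj G = b + e * t.
Proof. by rewrite /G adj_add adj_mul esa tsa bsa. Qed.

Let g := (1 + 1) * b * (1 + b).

Let ebb : e * (t * t) = t * t * e.
Proof. by rewrite -bb mulrA eb -mulrA eb mulrA. Qed.

Let GG : adj G * G = g.
Proof.
rewrite Gsa /G.
have -> : (b + e * t) * (b + t * e) =
    b * b + (e * (t * b) + b * (t * e)) + e * (t * t) * e by ncring.
rewrite ebb -[_ * e * e]mulrA ee mulr1 -bb tb (mulrA e) eb -mulrA -mulrDr et.
by rewrite /g; ncring.
Qed.

Let GG' : G * adj G = g.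
Proof.
rewrite Gsa /G.
have -> : (b + t * e) * (b + e * t) =
    b * b + (b * (e * t) + t * (e * b)) + t * (e * e) * t by ncring.
rewrite ee mulr1 -bb eb (mulrA t) tb -mulrA -mulrDr et.
by rewrite /g; ncring.
Qed.

Let gcomm Z : Z * b = b * Z -> Z * g = g * Z.
Proof.
move=> Zb; rewrite /g.
have -> : Z * ((1 + 1) * b * (1 + b)) = (1 + 1) * (Z * b + Z * b * b) by ncring.
have -> : (1 + 1) * b * (1 + b) * Z = (1 + 1) * (b * Z + b * (b * Z)) by ncring.
by rewrite Zb -!mulrA Zb.
Qed.

Let y := absop G.
Let yP : op_pos y /\ y * y = g.
Proof. by have [? ?] := absopP G; rewrite -GG. Qed.

Let ycomm Z : Z * b = b * Z -> Z * y = y * Z.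
Proof.
move=> Zb; have [ypos yy] := yP.
by apply: op_pos_comm => //; rewrite yy; exact: gcomm.
Qed.

Let g_inv : exists Y, Y * (y * y) = 1 /\ y * y * Y = 1.
Proof.
have [_ ->] := yP; exists (half *: (i * c)); split.
  rewrite -scaleAl ic.
  have -> : c * i * g = c * (i * b) * (1 + b) + c * (i * b) * (1 + b).
    by rewrite /g; ncring.
  by rewrite ib mulr1 c1b scalerDr half_scale.
rewrite -scaleAr ic.
have -> : g * (c * i) = b * ((1 + b) * c) * i + b * ((1 + b) * c) * i.
  by rewrite /g; ncring.
by rewrite bc1 mulr1 bi scalerDr half_scale.
Qed.

(** The unitary V is G / |G| and the positive factor D is 1/2 c |G|, so that
    V S D = 1/2 c G S whenever S commutes with b; Z is e t / b. *)
Lemma corner_factorization Q (T0 := p - Q) : p * t = Q ->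
  exists V D Z X : adjop H,
    [/\ [/\ adj V * V = 1, V * adj V = 1, adj Z * Z = 1 & Z * adj Z = 1],
        [/\ op_pos D, op_pos X, D * X = 1 & X * D = 1],
        T0 * b = b * T0 /\ (forall S, S * b = b * S -> S * D = D * S),
        matched_projection Q * (1 - Q) = V * (T0 * D)
      & (1 - matched_projection Q) * Q = V * (adj T0 * D) * Z].
Proof.
move=> ptQ.
have [j [jy yj]] : exists j, j * y = 1 /\ y * j = 1.
  by have [Y [Yy yY]] := g_inv; exact: (inverse_of_square Yy yY).
have [ypos yy] := yP.
have jcomm Z : Z * b = b * Z -> Z * j = j * Z.
  by move=> Zb; apply: inverse_comm jy yj _; exact: ycomm.
have jsa := inverse_sa jy yj (op_pos_sa ypos).
have Gb : G * b = b * G.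
  by rewrite /G mulrDl (mulrDr b); congr (_ + _); rewrite -mulrA eb mulrA tb mulrA.
have G'b : adj G * b = b * adj G.
  by rewrite Gsa mulrDl (mulrDr b); congr (_ + _); rewrite -mulrA tb mulrA eb mulrA.
have T0b : T0 * b = b * T0.
  by rewrite /T0 -ptQ mulrBl mulrBr pb; congr (_ - _); rewrite -mulrA tb mulrA pb mulrA.
have T0b' : adj T0 * b = b * adj T0.
  by rewrite -{1}bsa -adj_mul -T0b adj_mul bsa.
have cpos : op_pos c.
  apply: op_pos_inverse c1b bc1 _; apply: square_op_pos; apply: sa_squareD.
    by exists 1; rewrite ?adj_one ?mulr1.
  exact: op_pos_square.
have cb : c * b = b * c by rewrite comm_c.
have cy : c * y = y * c by exact: ycomm.
pose V := G * j; pose D := half *: (c * y); pose Z := e * (i * t).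
have VV : adj V * V = 1.
  rewrite /V adj_mul jsa -mulrA (mulrA (adj G)) GG -yy.
  by rewrite -mulrA yj mulr1 jy.
have VV' : V * adj V = 1.
  rewrite /V adj_mul jsa -mulrA -(jcomm _ G'b) (mulrA j) -(jcomm _ G'b).
  by rewrite !mulrA GG' -yy -!mulrA (mulrA y j) yj mul1r yj.
have half0 : 0 <= 2^-1 :> R by rewrite invr_ge0.
have Dpos : op_pos D.
  apply: square_op_pos; apply: sa_squareZ => //; apply: op_pos_square.
  exact: op_pos_mul.
pose X := (1 + 1) * (j * (1 + b)).
have DX : D * X = 1.
  rewrite /D /X -scaleAl mulrDl mul1r mulrDr scalerDr half_scale.
  by rewrite -mulrA (mulrA y) yj mul1r c1b.
have XD : X * D = 1.
  rewrite /D /X -scaleAr mulrDl mul1r mulrDl scalerDr half_scale.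
  by rewrite -mulrA (mulrA _ c) bc1 mul1r jy.
have Xpos := op_pos_inverse XD DX Dpos.
exists V, D, Z, X; split=> //.
- split=> //; first by rewrite adj_mul esa itsa -mulrA (mulrA e) ee mul1r itit.
  by rewrite adj_mul esa itsa /Z mulrA -(mulrA e) itit mulr1 ee.
- split=> // S Sb; rewrite /D -scaleAr -scaleAl; congr (_ *: _).
  by rewrite mulrA (comm_c Sb) -mulrA (ycomm Sb) mulrA.
- rewrite (matched_projectionE ptQ) -scaleAl /V /D -!scaleAr; congr (_ *: _).
  have -> : G * j * (T0 * (c * y)) = c * (G * T0).
    have -> : G * j * (T0 * (c * y)) = G * (j * (T0 * c) * y) by rewrite !mulrA.
    have T0c : T0 * c * b = b * (T0 * c) by rewrite -mulrA cb mulrA T0b mulrA.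
    by rewrite -(jcomm _ T0c) -(mulrA _ j) jy mulr1 (comm_c T0b) mulrA (comm_c Gb) mulrA.
  have ep : e * p = p by rewrite /e mulrBl mulrDl mul1r pp addrK.
  have GT0 : G * T0 = (b + t) * (p * (1 - t)).
    have -> : T0 = p * (1 - t) by rewrite /T0 -ptQ; ncring.
    by rewrite mulrA /G mulrDl -(mulrA t) ep -mulrDl mulrA.
  have -> : G * T0 = (1 + b) * ((b + t) * (p - 1)).
    rewrite GT0; have -> : p * (1 - t) = (1 + t) * (p - 1).
      by rewrite mulrBr mulr1 ptE; ncring.
    by rewrite mulrA bt_factor mulrA.
  rewrite (mulrA c) c1b mul1r -ptQ ptE.
  have -> : (1 + i * t) * (1 - (1 + t - t * p)) =
      (t + i * (t * t)) * (p - 1) by ncring.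
  by rewrite -bb (mulrA i) ib mul1r addrC.
- rewrite (matched_projectionE ptQ) -/m mC -scaleAl /V /D -!scaleAr -scaleAl.
  congr (_ *: _).
  have -> : G * j * (adj T0 * (c * y)) = c * (G * adj T0).
    have -> : G * j * (adj T0 * (c * y)) = G * (j * (adj T0 * c) * y).
      by rewrite !mulrA.
    have T0c : adj T0 * c * b = b * (adj T0 * c) by rewrite -mulrA cb mulrA T0b' mulrA.
    by rewrite -(jcomm _ T0c) -(mulrA _ j) jy mulr1 (comm_c T0b') mulrA (comm_c Gb) mulrA.
  have T0'E : adj T0 = p - t * p by rewrite /T0 adj_sub -ptQ adj_mul psa tsa.
  have eT0 : e * adj T0 = t * p - p.
    rewrite T0'E.
    have -> : e * (p - t * p) = p * p + p * p - p - (p * t * p + p * t * p - t * p).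
      by rewrite /e; ncring.
    by rewrite pp ptp; ncring.
  have -> : G * adj T0 = (1 + b) * ((b - t) * p).
    have -> : G * adj T0 = b * adj T0 + t * (e * adj T0) by rewrite /G; ncring.
    have -> : b * adj T0 + t * (e * adj T0) =
        (b - b * t + t * t - t) * p by rewrite eT0 T0'E; ncring.
    by rewrite -bb; ncring.
  have pe : p * e = p by rewrite /e mulrBr mulrDr mulr1 pp addrK.
  rewrite (mulrA c) c1b mul1r /Z.
  have -> : (b - t) * p * (e * (i * t)) = (b - t) * (p * e * i) * t by ncring.
  rewrite pe -ptQ (comm_i pb).
  have -> : (b - t) * (i * p) * t = (b * i - t * i) * (p * t) by ncring.
  by rewrite bi (comm_i tb).
Qed.
End MatchedPair.

Theorem theorem3p8 (R : realType) (A : cstarAlgType R) (H : hilbertModType A)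
    (Q : adjop H) (idemQ : is_idempotent Q) :
  semi_harmonious (matched_projection Q) Q <->
  has_polar_decomposition (proj_on (range Q) - Q).
Proof.
have [p [pproj <-] [ptQ [Y [Ytt ttY]]]] := idempotent_range_projection idemQ.
rewrite proj_on_range //.
set t := Q + adj Q - 1 in ptQ Ytt ttY.
have tsa : adj t = t by rewrite /t adj_sub adj_add adj_adj adj_one (addrC (adj Q)).
have pt : p * t + t * p = 1 + t.
  have -> : t * p = adj Q by rewrite -ptQ adj_mul tsa; case: pproj => _ ->.
  by rewrite ptQ /t addrCA subrr addr0.
have [bpos bb] := absopP t; rewrite tsa in bb.
have [i [ib bi]] : exists i, i * absop t = 1 /\ absop t * i = 1.
  by rewrite -bb in Ytt ttY; exact: inverse_of_square Ytt ttY.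
have [c [c1b bc1]] := inverse_1D (op_pos_square bpos).
have qpp := matched_quasi_projection_pair tsa pproj pt bpos bb ib bi c1b bc1 idemQ ptQ.
have [V [D [Z [X [[VV VV' ZZ ZZ'] [Dpos Xpos DX XD] [T0b Db] T1 T2]]]]] :=
  corner_factorization tsa pproj pt bpos bb ib bi c1b bc1 ptQ.
have T0'b : adj (p - Q) * absop t = absop t * adj (p - Q).
  by rewrite -{1}(op_pos_sa bpos) -adj_mul -T0b adj_mul op_pos_sa.
have one1 : adj (1 : adjop H) * 1 = 1 by rewrite adj_one mulr1.
have one1' : (1 : adjop H) * adj 1 = 1 by rewrite adj_one mulr1.
have DT : D * (adj (p - Q) * (p - Q)) = adj (p - Q) * (p - Q) * D.
  by rewrite mulrA -(Db _ T0'b) -mulrA -(Db _ T0b) mulrA.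
have DT' : D * ((p - Q) * adj (p - Q)) = (p - Q) * adj (p - Q) * D.
  by rewrite mulrA -(Db _ T0b) -mulrA -(Db _ T0'b) mulrA.
split=> [[_ polar1 _]|polar0].
  (* undo first the unitary V, then the factor D *)
  have polarD : has_polar_decomposition ((p - Q) * D).
    have V'V' : adj (adj V) * adj V = 1 by rewrite adj_adj.
    have := polar_unitary V'V' one1 one1' polar1.
    by rewrite T1 mulr1 mulrA VV mul1r.
  rewrite -[p - Q]mulr1 -DX mulrA; apply: (polar_mulr Xpos XD) polarD.
  apply/esym/(inverse_comm XD DX).
  have -> : adj ((p - Q) * D) * ((p - Q) * D) = D * (adj (p - Q) * (p - Q) * D).
    by rewrite adj_mul (op_pos_sa Dpos) !mulrA.
  have DaD a : D * a = a * D -> D * (a * D) * D = D * (D * (a * D)).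
    by move=> Da; rewrite -Da -mulrA -(mulrA D a) -Da.
  exact: DaD DT.
split=> //.
  rewrite T1 -[V * _]mulr1; apply: polar_unitary => //.
  exact: (polar_mulr Dpos DX DT).
rewrite T2; apply: polar_unitary => //.
apply: (polar_mulr Dpos DX); first by rewrite adj_adj DT'.
exact: polar_adj.
Qed.
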